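(* Let $G$ be a cyclically $4$-edge-connected cubic graph with a $2$-factor $C$ containing exactly two odd circuits $N_1,N_2$ and at least one even circuit $W$. Let $x_1y_1$, $y_1y_2$, $y_2x_2$ be edges of $G$ with $x_1\in V(N_1)$, $x_2\in V(N_2)$ and $y_1,y_2\in V(W)$. For $i\in\{1,2\}$ let $u_i,v_i$ be the two neighbours of $x_i$ on $N_i$, and let $w_i$ be the neighbour of $y_i$ on $W$ different from $y_{3-i}$. Let $F=G-E(C)$ and let $M$ be a maximum matching in $C-\{x_1,y_1,y_2,x_2\}$. Let $Z$ be the set consisting of, for $i\in\{1,2\}$, the edges of $N_i$ not incident with $x_i$ but incident with $u_i$ or $v_i$, and the edges of $W$ incident with $w_i$ but not incident with $y_i$ (i.e. not incident with $y_1$ or $y_2$). Suppose that: (i) there exist a smooth orientation of the circuits of the subgraph with edge set $(E(F)\setminus\{x_1y_1,x_2y_2\})\cup M$ and a smooth orientation of $C$ which agree on all edges of $Z$; (ii) the graph $G\sim x_1y_1\sim x_2y_2$ is cyclically $3$-edge-connected; and (iii) $G\sim x_1y_1\sim x_2y_2$ has no cycle-separating $3$-edge-cut $\{e_1,e_2,e_3\}$ with $e_1\in\{u_1v_1,u_2v_2,w_1w_2\}$ and $e_2,e_3\in (E(F)\setminus\{x_1y_1,x_2y_2\})\cup M$. Then $fn(G)=2$.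
   Context: A circuit is a connected $2$-regular graph; a cycle is a graph in which every vertex has even degree. A graph is cyclically $k$-edge-connected if the removal of fewer than $k$ edges cannot separate it into two components that both contain a cycle; an edge-cut is cycle-separating if both sides contain a cycle. A smooth orientation of a set of edge-disjoint circuits is an orientation in which, for every circuit of the set, each vertex of that circuit has exactly one incoming and one outgoing edge of that circuit. For an edge $e$ of a cubic graph $G$, $G\sim e$ denotes the cubic graph obtained from $G-e$ by smoothing the two resulting vertices of degree $2$ (each is removed and its two neighbours are joined by a new edge); thus in $G\sim x_1y_1\sim x_2y_2$ the edges $u_1v_1$, $u_2v_2$, $w_1w_2$ are the new edges arising from smoothing, and the other edges are identified with edges of $G$. An orientation is strong if for every ordered pair of distinct vertices $u,v$ there is a directed $uv$-path. An edge is deletable in an orientation $(G,o)$ if the restriction of $o$ to the remaining edges is a strong orientation of the graph with that edge removed. For a $3$-edge-connected graph $G$, $fn(G)$ is the minimum number $k$ such that $G$ admits $k$ orientations with every edge deletable in at least one of them. *)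

(* Defs.v *)
From mathcomp Require Import all_boot.
Set Implicit Arguments. Unset Strict Implicit. Unset Printing Implicit Defensive.

Record mgraph (V E : finType) := MGraph {
  vs : {set V}; es : {set E}; ends : E -> V * V }.

Section Graphs.
Variables (V E : finType).
Implicit Types (g : mgraph V E) (C M D S : {set E}) (X : {set V}) (o : E -> bool).

Definition wf g := forall e, e \in es g -> ((ends g e).1 \in vs g) /\ ((ends g e).2 \in vs g).

Definition incident g e v := ((ends g e).1 == v) || ((ends g e).2 == v).
Definition joins g e x y := (ends g e == (x, y)) || (ends g e == (y, x)).

(* degree of v in the edge set D (a loop counts twice) *)
Definition degS g D v : nat :=
  \sum_(e in D) (((ends g e).1 == v) + ((ends g e).2 == v)).

Definition touches g D v := [exists e in D, incident g e v].

Definition cubic g := wf g /\ forall v, v \in vs g -> degS g (es g) v = 3.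

Definition adj g D : rel V :=
  [rel u v | [exists e in D, joins g e u v]].
Definition circuit g D :=
  [/\ D \subset es g, D != set0,
      forall v, touches g D v -> degS g D v = 2 &
      forall u v, touches g D u -> touches g D v -> connect (adj g D) u v].

Definition two_factor g C := C \subset es g /\ forall v, v \in vs g -> degS g C v = 2.

Definition inside g X := [set e in es g | ((ends g e).1 \in X) && ((ends g e).2 \in X)].
Definition has_cycle g X :=
  exists D, [/\ D != set0, D \subset inside g X & forall v, ~~ odd (degS g D v)].
Definition cut g X := [set e in es g | ((ends g e).1 \in X) != ((ends g e).2 \in X)].
Definition cycle_separating g X :=
  [/\ X \subset vs g, has_cycle g X & has_cycle g (vs g :\: X)].
Definition cyc_conn g (k : nat) :=
  forall X, cycle_separating g X -> k <= #|cut g X|.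

Definition tail g o e := if o e then (ends g e).1 else (ends g e).2.
Definition head g o e := if o e then (ends g e).2 else (ends g e).1.

Definition smooth_circuits g S o :=
  forall D, circuit g D -> D \subset S -> forall v, touches g D v ->
    #|[set e in D | head g o e == v]| = 1 /\ #|[set e in D | tail g o e == v]| = 1.

Definition matching_in g C (R : {set V}) M :=
  [/\ M \subset C,
      forall e, e \in M -> [/\ (ends g e).1 != (ends g e).2,
                              (ends g e).1 \notin R & (ends g e).2 \notin R] &
      forall e f v, e \in M -> f \in M -> e != f -> incident g e v -> ~~ incident g f v].
Definition max_matching_in g C R M :=
  matching_in g C R M /\ forall M', matching_in g C R M' -> #|M'| <= #|M|.

Definition darc g D o : rel V := [rel a b | [exists f in D, (tail g o f == a) && (head g o f == b)]].
Definition strong_on g D o :=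
  forall u v, u \in vs g -> v \in vs g -> u != v -> connect (darc g D o) u v.
Definition deletable g o e := strong_on g (es g :\ e) o.
Definition fn_admits g (k : nat) :=
  exists os : 'I_k -> E -> bool, forall e, e \in es g -> exists i, deletable g (os i) e.
Definition fn_is g (k : nat) := fn_admits g k /\ forall j, j < k -> ~ fn_admits g j.
End Graphs.

Definition Zset (V E : finType) (g : mgraph V E) (N1 N2 W : {set E})
    (x1 x2 y1 y2 u1 v1 u2 v2 w1 w2 : V) : {set E} :=
  [set e in N1 | ~~ incident g e x1 && (incident g e u1 || incident g e v1)] :|:
  [set e in N2 | ~~ incident g e x2 && (incident g e u2 || incident g e v2)] :|:
  [set e in W | [&& incident g e w1 || incident g e w2, ~~ incident g e y1 & ~~ incident g e y2]].

(* G ~ x1y1 ~ x2y2, where G is the multigraph on all of V and E with endpoints en.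
   Vertices x1,y1,x2,y2 are removed, all edges incident with them are removed,
   and three new edges inr 0 = u1v1, inr 1 = u2v2, inr 2 = w1w2 are added;
   the other edges (inl e) are identified with edges e of G. *)
Definition smooth2_ends (V E : finType) (en : E -> V * V) (u1 v1 u2 v2 w1 w2 : V)
    (e : E + 'I_3) : V * V :=
  match e with
  | inl f => en f
  | inr i => if val i == 0 then (u1, v1) else if val i == 1 then (u2, v2) else (w1, w2)
  end.

Definition smooth2 (V E : finType) (en : E -> V * V) (x1 y1 x2 y2 u1 v1 u2 v2 w1 w2 : V)
  : mgraph V (E + 'I_3)%type :=
  let G := MGraph setT setT en in
  MGraph (~: [set x1; y1; x2; y2])
         [set e | match e with
                  | inl f => ~~ [|| incident G f x1, incident G f y1,
                                    incident G f x2 | incident G f y2]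
                  | inr _ => true end]
         (smooth2_ends en u1 v1 u2 v2 w1 w2).

(* Main.v *)
(* Let G' = G ~ x1y1 ~ x2y2. A maximum matching M covers all vertices other than the
   x_i, y_i, so H = (F - {x1y1, x2y2}) + M is 2-regular there, and the two smooth
   orientations give integer flows phi1 (on H) and phi2 (on C) with values +-1. The
   flows A = phi1 + 2 phi2 and B = phi2 - 2 phi1 vanish only on x1y1 and x2y2 and
   induce nowhere-zero flows on G'; orient G' by their signs. As G' is 3-edge-connected,
   an edge of value 1 is deletable, and an edge of value 2 is deletable unless it lies
   in a 3-edge-cut with two edges of value 1. Every edge has value 1 in A or in B.
   The edges u_i v_i and w1 w2 have value 1 in B and 2 in A; they are deletable in A
   too, by (iii) and because the edges of Z, where phi1 and phi2 agree, have value 3.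
   Back in G, the orientations of x1y1 and x2y2 under A and B are opposite, so that
   each edge arising from the subdivision is deletable in one of the two. *)

(* That M misses no other vertex is a matter of parity: deleting x_i from an odd circuit, or the
   adjacent pair y1, y2 from W, leaves a path with an even number of vertices, and every other
   circuit of C is even. The coefficients are chosen for the edges of M, the only ones carrying both
   flows: according to whether the two orientations agree there, the absolute values of phi1 + 2
   phi2 and phi2 - 2 phi1 are 3 and 1 or 1 and 3, so one of them is always 1. The zeros on x1y1 and
   x2y2 are what forces the detour through G': no sign orients these two edges, which are directed
   by hand afterwards. This freedom is also what saves the special edges. Both flows direct the
   smoothed paths in the same way, so for a fixed direction of x1y1 and x2y2 some path edge is the
   only one entering or leaving a vertex, under either flow; reversing the two edges frees it.
   Condition (iii) concerns cycle-separating cuts only. A 3-edge-cut with an acyclic side cuts off a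
   single vertex of the cubic graph, and this is where agreement on Z is needed. *)
Require Import Defs.
From mathcomp Require Import all_boot all_order all_algebra zify ring.
Set Implicit Arguments. Unset Strict Implicit. Unset Printing Implicit Defensive.

(** * Degrees, circuits and components *)

Section Degrees.
Variables (V E : finType) (g : mgraph V E).
Implicit Types (S D : {set E}) (e f : E) (v : V).

Lemma joinsP e x y : joins g e x y -> ends g e = (x, y) \/ ends g e = (y, x).
Proof. by case/orP=> /eqP; auto. Qed.

Lemma joins_incident e x y : joins g e x y -> incident g e x && incident g e y.
Proof. by rewrite /incident => /joinsP[] -> /=; rewrite !eqxx !orbT. Qed.

Lemma touchesP S v : reflect (exists2 e, e \in S & incident g e v) (touches g S v).
Proof.
by apply: (iffP existsP) => [[e /andP[]]|[e eS ev]]; exists e => //; rewrite eS.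
Qed.

Lemma degS_incident e v :
  (0 < ((ends g e).1 == v) + ((ends g e).2 == v))%N = incident g e v.
Proof. by rewrite /incident; do 2!case: eqP. Qed.

Lemma degS_gt0 S v : (0 < degS g S v)%N = touches g S v.
Proof.
rewrite lt0n /degS sum_nat_eq0 negb_forall.
by apply: eq_existsb => e; rewrite negb_imply -lt0n degS_incident.
Qed.

Lemma degSID S D v : degS g S v = (degS g (S :&: D) v + degS g (S :\: D) v)%N.
Proof. by rewrite /degS (big_setID D). Qed.

(** Degrees add up over [S :&: D] and [S :\: D], so no degree is left at [v] for an edge outside
    [D]. This serves both for circuits in 2-regular sets and for the stars of cubic vertices. *)
Lemma degS_subset_eq S D e v : D \subset S -> (degS g S v <= degS g D v)%N ->
  e \in S -> incident g e v -> e \in D.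
Proof.
move=> sDS; rewrite (degSID S D) (setIidPr sDS) => le eS ev.
apply: contraT => eD; have: touches g (S :\: D) v.
  by apply/touchesP; exists e; rewrite // inE eD.
rewrite -degS_gt0; lia.
Qed.

Lemma touchesS S D v : D \subset S -> touches g D v -> touches g S v.
Proof.
by move=> /subsetP s /touchesP[e eD ev]; apply/touchesP; exists e; rewrite ?s.
Qed.

Lemma incident1 e : incident g e (ends g e).1.
Proof. by rewrite /incident eqxx. Qed.

Lemma incident2 e : incident g e (ends g e).2.
Proof. by rewrite /incident eqxx orbT. Qed.

Lemma incident_head o e : incident g e (Defs.head g o e).
Proof. by rewrite /Defs.head; case: ifP; rewrite ?incident1 ?incident2. Qed.

Lemma incident_tail o e : incident g e (tail g o e).
Proof. by rewrite /tail; case: ifP; rewrite ?incident1 ?incident2. Qed.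

Lemma adj_ends S e : e \in S -> adj g S (ends g e).1 (ends g e).2.
Proof.
by move=> eS; apply/existsP; exists e; rewrite eS /joins -surjective_pairing eqxx.
Qed.

Lemma adj_sym S : symmetric (adj g S).
Proof. by move=> x y; apply: eq_existsb => e; rewrite /joins orbC. Qed.

Lemma incident_connect S e u v :
  e \in S -> incident g e u -> incident g e v -> connect (adj g S) u v.
Proof.
move=> eS; have a12 := adj_ends eS; have a21 := a12; rewrite adj_sym in a21.
by case/orP=> /eqP <- /orP[] /eqP <-; rewrite ?connect0 // connect1.
Qed.

End Degrees.

Section TwoRegular.
Variables (V E : finType) (g : mgraph V E) (S : {set E}).
Hypothesis S_reg : forall v, touches g S v -> degS g S v = 2.
Hypothesis S_es : S \subset es g.
Implicit Types (D : {set E}) (e : E) (u v : V).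

Lemma circuit_closed D e v : circuit g D -> D \subset S ->
  touches g D v -> e \in S -> incident g e v -> e \in D.
Proof.
case=> _ _ degD _ sDS Dv eS ev; apply: (degS_subset_eq sDS) (ev) => //.
by rewrite degD // S_reg // (touchesS sDS).
Qed.

Lemma circuit_touches D u v : circuit g D -> D \subset S -> touches g D v ->
  connect (adj g S) v u -> touches g D u.
Proof.
move=> cD sDS Dv /connectP[p + ->]; elim: p v Dv => //= w p IH v Dv /andP[].
case/existsP=> e /andP[eS /joins_incident/andP[ev ew]]; apply: IH.
by apply/touchesP; exists e => //; apply: circuit_closed ev.
Qed.

Lemma circuit_subset D1 D2 v : circuit g D1 -> circuit g D2 ->
  D1 \subset S -> D2 \subset S -> touches g D1 v -> touches g D2 v ->
  D1 \subset D2.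
Proof.
move=> [_ _ _ con1] c2 s1 s2 t1 t2; apply/subsetP=> e e1.
have eS := subsetP s1 _ e1.
apply: (circuit_closed c2 s2 _ eS (incident1 g e)).
apply: (circuit_touches c2 s2 t2).
have: connect (adj g D1) v (ends g e).1.
  by apply: con1 => //; apply/touchesP; exists e; rewrite ?incident1.
apply: connect_sub => a b /existsP[f /andP[f1 jf]]; apply: connect1.
by apply/existsP; exists f; rewrite (subsetP s1).
Qed.

Lemma circuit_unique D1 D2 v : circuit g D1 -> circuit g D2 ->
  D1 \subset S -> D2 \subset S -> touches g D1 v -> touches g D2 v -> D1 = D2.
Proof.
move=> c1 c2 s1 s2 t1 t2; apply/eqP; rewrite eqEsubset.
by rewrite (circuit_subset c1 c2 s1 s2 t1 t2) (circuit_subset c2 c1 s2 s1 t2 t1).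
Qed.

(** Testing the first end is enough: the two ends of an edge of [S] are connected in [S]. *)
Definition component v := [set e in S | connect (adj g S) v (ends g e).1].

Lemma component_sub v : component v \subset S.
Proof. by apply/subsetP=> e; rewrite inE => /andP[]. Qed.

Lemma component_incident u v e : e \in S -> incident g e u ->
  (e \in component v) = connect (adj g S) v u.
Proof.
move=> eS eu; rewrite inE eS /=; apply: same_connect_r.
  exact/sym_connect_sym/adj_sym.
exact: incident_connect eS (incident1 g e) eu.
Qed.

Lemma component_circuit v : touches g S v -> circuit g (component v).
Proof.
have adjS := sym_connect_sym (@adj_sym _ _ g S).
case/touchesP=> e eS ev.
have Dtouch u : touches g (component v) u -> connect (adj g S) v u.
  case/touchesP=> f fD fu; rewrite -(component_incident v _ fu) //.
  exact: (subsetP (component_sub v)).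
split.
- exact: subset_trans (component_sub v) S_es.
- by apply/set0Pn; exists e; rewrite (component_incident _ eS ev).
- move=> u Du; rewrite -(S_reg (touchesS (component_sub v) Du)) /degS.
  rewrite [RHS](bigID (mem (component v))) /= [X in (_ + X)%N]big1 => [|f].
    rewrite addn0; apply: eq_bigl => f.
    by rewrite andb_idl // => /(subsetP (component_sub v)).
  case/andP=> fS fD; apply/eqP; rewrite -leqn0 leqNgt degS_incident.
  by apply: contra fD => fu; rewrite (component_incident _ fS fu) Dtouch.
move=> a c /Dtouch va /Dtouch vc.
have: connect (adj g S) a c by apply: connect_trans vc; rewrite adjS.
case/connectP=> p + ->; elim: p a va => //= w p IH a va /andP[aw pp].
have /existsP[f /andP[fS jf]] := aw; have /andP[fa fw] := joins_incident jf.
apply: connect_trans (IH _ (connect_trans va (connect1 aw)) pp).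
by apply: connect1; apply/existsP; exists f; rewrite jf (component_incident _ fS fa) va.
Qed.

Lemma component_touches v : touches g S v -> touches g (component v) v.
Proof.
by case/touchesP=> e eS ev; apply/touchesP; exists e; rewrite ?(component_incident _ eS ev).
Qed.

(** Smoothness speaks of one circuit at a time, but the component of [v] is a circuit that contains
    every edge of [S] at [v]. *)
Lemma smooth_vertex o v : smooth_circuits g S o -> touches g S v ->
  #|[set e in S | Defs.head g o e == v]| = 1 /\ #|[set e in S | tail g o e == v]| = 1.
Proof.
move=> sm Sv; have Dv := component_touches Sv.
have cD := component_circuit Sv; have sDS := component_sub v.
have star (k : E -> V) : (forall e, incident g e (k e)) ->
  [set e in component v | k e == v] = [set e in S | k e == v].
  move=> ke; apply/setP=> e; rewrite !inE.
  case: (boolP (e \in S)) => //= eS; case: eqP => [kv|]; rewrite ?andbF // andbT.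
  by have := component_incident v eS (ke e); rewrite inE eS kv connect0.
rewrite -!star; first exact: sm cD sDS _ Dv.
  exact: incident_tail.
exact: incident_head.
Qed.

End TwoRegular.

(** * Cuts and deletable edges *)

Lemma sum_eq_mem (T : finType) (X : {set T}) (a : T) :
  \sum_(v in X) (a == v : nat) = (a \in X).
Proof.
case: (boolP (a \in X)) => aX.
  rewrite (bigD1 a) //= eqxx big1 // => v /andP[_ /negPf].
  by rewrite eq_sym => ->.
by rewrite big1 // => v vX; case: eqP aX => // ->; rewrite vX.
Qed.

Section CubicCuts.
Variables (V E : finType) (g : mgraph V E).
Implicit Types (D : {set E}) (X : {set V}).

Lemma sum_degS D X : \sum_(v in X) degS g D v =
  \sum_(e in D) (((ends g e).1 \in X) + ((ends g e).2 \in X)).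
Proof.
rewrite exchange_big /=; apply: eq_bigr => e _.
by rewrite big_split /= !sum_eq_mem.
Qed.

Lemma odd_degS_symdiff D1 D2 v :
  odd (degS g ((D1 :\: D2) :|: (D2 :\: D1)) v) =
  odd (degS g D1 v) (+) odd (degS g D2 v).
Proof.
rewrite (degSID g D1 D2) (degSID g D2 D1) [D2 :&: D1]setIC.
rewrite /degS (bigID (mem D1)) /= !oddD.
rewrite (eq_bigl (mem (D1 :\: D2))) => [|e]; last first.
  by rewrite !inE; case: (e \in D1); case: (e \in D2).
rewrite [in X in _ (+) X = _](eq_bigl (mem (D2 :\: D1))) => [|e]; last first.
  by rewrite !inE; case: (e \in D1); case: (e \in D2).
by do 3!case: (odd _).
Qed.

Lemma degS_inside_out D X v : D \subset inside g X -> v \notin X -> degS g D v = 0.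
Proof.
move=> /subsetP sD vX; rewrite /degS big1 // => e /sD.
rewrite inE => /and3P[_ e1 e2]; apply/eqP; rewrite -leqn0 leqNgt degS_incident.
by apply: contra vX => /orP[] /eqP <-.
Qed.

(* More than |X| - 1 edges inside X would give two distinct edge sets with the
   same degree parities on X, whose symmetric difference is a cycle. *)
Lemma card_inside_acyclic X : X != set0 -> ~ has_cycle g X ->
  (#|inside g X| < #|X|)%N.
Proof.
case/set0Pn=> v0 v0X acyc.
(* The parity at [v0] is omitted because the handshake lemma determines it from the others; this
   makes the final bound strict. *)
pose par (D : {set E}) := [set v in X :\ v0 | odd (degS g D v)].
have sum_even D : D \subset inside g X -> ~~ odd (\sum_(v in X) degS g D v).
  move=> /subsetP sD; rewrite sum_degS (eq_bigr (fun=> 2)) => [|e /sD].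
    by rewrite sum_nat_const muln2 odd_double.
  by rewrite inE => /and3P[_ -> ->].
have par_inj : {in powerset (inside g X) &, injective par}.
  move=> D1 D2; rewrite !powersetE => s1 s2 eq_par.
  apply/eqP; rewrite eqEsubset -!setD_eq0 -setU_eq0; apply: contraT => neq.
  case: acyc; exists ((D1 :\: D2) :|: (D2 :\: D1)).
  have par_v v : v \in X :\ v0 -> odd (degS g D1 v) = odd (degS g D2 v).
    by move=> vX; have /setP/(_ v) := eq_par; rewrite [LHS]inE [RHS]inE vX.
  split=> //; first by rewrite subUset !(subset_trans (subsetDl _ _)).
  move=> v; rewrite odd_degS_symdiff.
  case: (boolP (v \in X)) => vX; last by rewrite !(@degS_inside_out _ X).
  case: (eqVneq v v0) => [->|v_v0]; last first.
    by rewrite par_v ?addbb // !inE v_v0.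
  have deg_v0 D : D \subset inside g X ->
      odd (degS g D v0) = \big[addb/false]_(w in X :\ v0) odd (degS g D w).
    move/sum_even; rewrite (big_setD1 v0 v0X) /= oddD.
    rewrite (big_morph odd oddD (erefl _)).
    by case: (odd (degS g D v0)); case: (\big[_/_]_(_ in _) _).
  by rewrite !deg_v0 // (eq_bigr _ par_v) addbb.
rewrite -(ltn_exp2l _ _ (ltnSn 1)) -card_powerset -(card_in_imset par_inj).
apply: leq_ltn_trans (_ : #|powerset (X :\ v0)| < _)%N.
  apply: subset_leq_card; apply/subsetP=> _ /imsetP[D _ ->].
  by rewrite powersetE; apply/subsetP=> v; rewrite inE => /andP[].
by rewrite card_powerset ltn_exp2l // (cardsD1 v0 X) v0X.
Qed.

Lemma sum_degS_cut X :
  \sum_(v in X) degS g (es g) v = 2 * #|inside g X| + #|cut g X|.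
Proof.
rewrite sum_degS -!sum1_card big_distrr /=.
rewrite [X in _ = X + _](eq_bigl (fun e => (e \in es g) &&
  (((ends g e).1 \in X) && ((ends g e).2 \in X)))); last by move=> e; rewrite inE.
rewrite [X in _ = _ + X](eq_bigl (fun e => (e \in es g) &&
  (((ends g e).1 \in X) != ((ends g e).2 \in X)))); last by move=> e; rewrite inE.
rewrite !big_mkcondr -big_split /=; apply: eq_bigr => e _.
by do 2!case: (_ \in X).
Qed.

(** Combine 3|X| = 2|inside| + |cut| with |inside| <= |X| - 1. Hence an acyclic side of a 3-edge-cut
    is a single vertex. *)
Lemma acyclic_cut X : X \subset vs g ->
  (forall v, v \in vs g -> degS g (es g) v = 3) ->
  X != set0 -> ~ has_cycle g X -> (#|X| + 2 <= #|cut g X|)%N.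
Proof.
move=> /subsetP sX deg3 X0 /(card_inside_acyclic X0) ltX.
have := sum_degS_cut X; rewrite (eq_bigr (fun=> 3)) => [|v /sX/deg3//].
rewrite sum_nat_const; lia.
Qed.

Lemma cut_compl X : wf g -> cut g (vs g :\: X) = cut g X.
Proof.
move=> wf_g; apply/setP=> e; rewrite !inE; apply: andb_id2l => /wf_g[-> ->].
by rewrite !andbT; do 2!case: (_ \in X).
Qed.

(** Cyclic connectivity bounds only the cuts with cycles on both sides; a nonempty acyclic side
    already forces 1 + 2 cut edges. *)
Lemma cyc_conn3_cut X : cubic g -> cyc_conn g 3 -> X \subset vs g ->
  X != set0 -> X != vs g -> (3 <= #|cut g X|)%N.
Proof.
move=> [wf_g deg3] conn sX X0 XV; rewrite leqNgt; apply/negP => small.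
(* [has_cycle] is an undecided [Prop]; a double negation suffices since the goal is [False]. *)
have big (Y : {set V}) : Y \subset vs g -> Y != set0 -> cut g Y = cut g X -> ~ ~ has_cycle g Y.
  move=> sY Y0 eqY acyc; have := acyclic_cut sY deg3 Y0 acyc.
  by move: Y0; rewrite -card_gt0 eqY; lia.
apply: (big X) => // cX; apply: (big (vs g :\: X)); rewrite ?subsetDl ?cut_compl //.
  by rewrite setD_eq0; apply: contraNN XV => sVX; rewrite eqEsubset sX.
by move=> cXc; have := conn X (And3 sX cX cXc); lia.
Qed.

End CubicCuts.

(** * Integer flows and their sign orientations *)

Section Flows.
Variables (V E : finType) (g : mgraph V E).
Local Open Scope ring_scope.
Implicit Types (phi : E -> int) (e : E) (v : V) (X : {set V}).

(** The signed incidence matrix, with inflow positive; a loop contributes 0. *)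
Definition netin e v : int := ((ends g e).2 == v)%:Z - ((ends g e).1 == v)%:Z.

Lemma sum_netin X e :
  \sum_(v in X) netin e v = ((ends g e).2 \in X)%:Z - ((ends g e).1 \in X)%:Z.
Proof. by rewrite GRing.sumrB -!(big_morph Posz PoszD (erefl _)) !sum_eq_mem. Qed.

Definition is_flow phi := forall v, v \in vs g -> \sum_(e in es g) phi e * netin e v = 0.

Lemma flow_cut phi X : is_flow phi -> X \subset vs g ->
  \sum_(e in cut g X) phi e * (((ends g e).2 \in X)%:Z - ((ends g e).1 \in X)%:Z) = 0.
Proof.
move=> flow /subsetP sX.
transitivity (\sum_(v in X) \sum_(e in es g) phi e * netin e v); last first.
  by rewrite big1 // => v /sX/flow.
rewrite exchange_big /= (eq_bigl (fun e => (e \in es g) &&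
  (((ends g e).1 \in X) != ((ends g e).2 \in X)))); last by move=> e; rewrite inE.
rewrite big_mkcondr /=; apply: eq_bigr => e _.
rewrite -GRing.mulr_sumr sum_netin.
by do 2!case: (_ \in X); rewrite ?GRing.subrr ?GRing.mulr0.
Qed.

(* Across a directed cut of G - e, the value of e is the sum of the values of the
   at least two other edges of the cut. *)
Lemma deletable_flow phi e : wf g ->
  (forall X, X \subset vs g -> X != set0 -> X != vs g -> (3 <= #|cut g X|)%N) ->
  (forall f, f \in es g -> phi f != 0) -> is_flow phi ->
  (absz (phi e) <= 2)%N ->
  (forall X e2 e3, X \subset vs g -> X != set0 -> X != vs g ->
     cut g X = [set e; e2; e3] -> #|cut g X| = 3%N ->
     absz (phi e2) = 1%N -> absz (phi e3) = 1%N -> absz (phi e) != 2%N) ->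
  deletable g (fun f => 0 < phi f) e.
Proof.
move=> wf_g conn3 nz flow le2 no_cut u v uV vV uv; apply: contraT => ncon.
(* Being closed under the remaining arcs, [X] is entered by every cut edge other than [e], so each
   of these counts in the cut sum with its absolute value. *)
set o := fun f => _ in ncon; pose X := [set w in vs g | connect (darc g (es g :\ e) o) u w].
have sX : X \subset vs g by apply/subsetP=> w; rewrite inE => /andP[].
have X0 : X != set0 by apply/set0Pn; exists u; rewrite inE uV connect0.
have XV : X != vs g.
  by apply: contraNneq ncon => /setP/(_ v); rewrite inE vV.
have closed f : f \in es g -> f != e -> tail g o f \in X -> Defs.head g o f \in X.
  move=> fE fe; rewrite !inE => /andP[_ ut].
  have -> /= : Defs.head g o f \in vs g.
    by rewrite /Defs.head; case: ifP; case: (wf_g _ fE).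
  apply: connect_trans ut (connect1 _); apply/existsP; exists f.
  by rewrite !inE fE fe !eqxx.
have val f : f \in cut g X -> f != e ->
    phi f * (((ends g f).2 \in X)%:Z - ((ends g f).1 \in X)%:Z) = (absz (phi f))%:Z.
  rewrite inE => /andP[fE cutf] fe; have := closed f fE fe.
  rewrite /tail /Defs.head /o; move: cutf.
  by case: ifP; do 2!case: (_ \in X) => //=; try (move=> _ _ /(_ isT)//); lia.
have pos f : f \in cut g X -> (1 <= absz (phi f))%N.
  by rewrite inE => /andP[/nz]; lia.
have := flow_cut flow sX; have := conn3 X sX X0 XV.
case: (boolP (e \in cut g X)) => ecut; last first.
  move=> c3; rewrite (eq_bigr (fun f => (absz (phi f))%:Z)) => [|f fc]; last first.
    by apply: val => //; apply: contraNneq ecut => <-.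
  rewrite -!(big_morph Posz PoszD (erefl _)) => -[] /eqP.
  rewrite sum_nat_eq0 => /forallP H.
  have /card_gt0P[f fc] : (0 < #|cut g X|)%N by lia.
  by have := H f; rewrite fc => /= /eqP; have := pos f fc; lia.
rewrite (big_setD1 e ecut) /= (eq_bigr (fun f => (absz (phi f))%:Z)); last first.
  by move=> f; rewrite in_setD1 => /andP[fe fc]; apply: val.
rewrite -(big_morph Posz PoszD (erefl _)) (cardsD1 e) ecut => c3 sum0.
have ub : (\sum_(f in cut g X :\ e) absz (phi f) <= absz (phi e))%N.
  by move: sum0; do 2!case: (_ \in X); lia.
have lb : (#|cut g X :\ e| <= \sum_(f in cut g X :\ e) absz (phi f))%N.
  rewrite -sum1_card; apply: leq_sum => f; rewrite in_setD1 => /andP[_]; exact: pos.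
(* At least two other cut edges, each of value at least 1, share a total of at most 2. *)
have /cards2P[e2 [e3 [e23 eqc]]] : #|cut g X :\ e| == 2 by lia.
have eqC : cut g X = [set e; e2; e3].
  by rewrite -(setD1K ecut) eqc setUA.
have c2 : e2 \in cut g X by rewrite eqC !inE eqxx orbT.
have c3' : e3 \in cut g X by rewrite eqC !inE eqxx orbT.
move: ub; rewrite eqc big_setU1 ?inE //= big_set1 => ub.
have := pos _ c2; have := pos _ c3'; clear -ub le2 no_cut sX X0 XV eqC e23 eqc ecut.
move=> p3 p2; have [v2 v3 ve] : [/\ absz (phi e2) = 1, absz (phi e3) = 1 & absz (phi e) = 2]%N.
  by clear -ub le2 p2 p3; split; lia.
have := no_cut X e2 e3 sX X0 XV eqC _ v2 v3; rewrite ve => /(_ _)/negP[] //.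
by rewrite (cardsD1 e) ecut eqc cards2 e23.
Qed.

End Flows.

(** * Smooth orientations and perfect matchings *)

Section SmoothFlow.
Variables (V E : finType) (g : mgraph V E).

Definition orient_sign (d : bool) : int := (if d then 1 else -1)%R.

Lemma orient_sign_netin (o : E -> bool) e v : (orient_sign (o e) * netin g e v =
  (Defs.head g o e == v)%:Z - (tail g o e == v)%:Z)%R.
Proof. by rewrite /orient_sign /netin /Defs.head /tail; case: (o e); lia. Qed.

Lemma smooth_flow (S : {set E}) o v :
  (forall w, touches g S w -> degS g S w = 2) -> S \subset es g ->
  smooth_circuits g S o -> (\sum_(e in S) orient_sign (o e) * netin g e v = 0)%R.
Proof.
move=> reg sS sm; under eq_bigr do rewrite orient_sign_netin.
case: (boolP (touches g S v)) => [Sv|nSv]; last first.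
  apply: big1 => e eS; suff ninc u : incident g e u -> (u == v) = false.
    by rewrite !ninc ?incident_head ?incident_tail.
  by apply: contraTF => /eqP->; apply: contra nSv => ev; apply/touchesP; exists e.
have [inS outS] := smooth_vertex reg sS sm Sv.
have count (k : E -> V) : \sum_(e in S) (k e == v) = #|[set e in S | k e == v]|.
  rewrite -sum1_card [RHS](eq_bigl (fun e => (e \in S) && (k e == v))).
    by rewrite [RHS]big_mkcondr; apply: eq_bigr => e _; case: eqP.
  by move=> e; rewrite inE.
by rewrite GRing.sumrB -!(big_morph Posz PoszD (erefl _)) !count inS outS.
Qed.

End SmoothFlow.

(* Take every second element of each orbit of s, starting at x1, x2 or t in their
   orbits, at index 0 in even orbits and 1 in odd ones; then drop t. *)
Lemma alternating_set (T : finType) (s : T -> T) (x1 x2 t : T) :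
  injective s -> odd (order s x1) -> odd (order s x2) -> ~~ fconnect s x1 x2 ->
  ~~ odd (order s t) ->
  (forall v, odd (order s v) -> fconnect s x1 v || fconnect s x2 v) ->
  exists A : {set T},
    (forall v, v \in A -> [&& s v \notin A, v \notin [:: x1; x2; t; s t]
                                        & s v \notin [:: x1; x2; t; s t]]) /\
    (forall v, v \notin [:: x1; x2; t; s t] ->
       v \in A \/ exists2 u, u \in A & s u = v).
Proof.
move=> s_inj odd1 odd2 x12 even_t odd_orbits.
have symf := fconnect_sym s_inj.
have ord_eq u v : fconnect s u v -> order s u = order s v.
  by move=> uv; apply/eq_card/(same_connect symf).
pose r v := if fconnect s x1 v then x1 else if fconnect s x2 v then x2 else
            if fconnect s t v then t else froot s v.
have rP v : fconnect s (r v) v.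
  by rewrite /r; do 3!case: ifP => [//|_]; rewrite symf connect_root.
have r_s v : r (s v) = r v.
  rewrite /r -!same_fconnect1_r //; do 3!case: ifP => // _.
  by apply/esym/eqP; rewrite root_connect ?fconnect1.
pose idx v := findex s (r v) v.
(* An odd orbit gets the indices 1, 3, ..., order - 2, which leaves only its start unpaired; an even
   orbit gets 0, 2, ..., order - 2, which pairs everything. *)
pose sel v := odd (idx v) == odd (order s v).
have r1 : r x1 = x1 by rewrite /r connect0.
have r2 : r x2 = x2 by rewrite /r (negPf x12) connect0.
have rt : r t = t.
  rewrite /r; case: ifP => [/ord_eq eq_t|_]; first by rewrite -eq_t odd1 in even_t.
  case: ifP => [/ord_eq eq_t|_]; first by rewrite -eq_t odd2 in even_t.
  by rewrite connect0.
have idx0 v : r v = v -> idx v = 0 by rewrite /idx => ->; rewrite findex0.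
(* The second case is the wrap-around to the start of the orbit: the last index, order - 1, has the
   wrong parity and is never selected. *)
have step v : sel (s v) = ~~ sel v /\ r (s v) <> s v \/
    [/\ r (s v) = s v, sel (s v) = ~~ odd (order s v) & sel v = false].
  have lt := findex_max (rP v); rewrite (ord_eq _ _ (rP v)) -/(idx v) in lt.
  have it : s v = iter (idx v).+1 s (r v) by rewrite iterS iter_findex.
  have os : order s (s v) = order s v by apply/esym/ord_eq/fconnect1.
  case: (ltngtP (idx v).+1 (order s v)) lt => // [lt|eq] _; [left|right].
    have idx_s : idx (s v) = (idx v).+1.
      by rewrite /idx r_s it findex_iter // (ord_eq _ _ (rP v)).
    split; last by move/idx0; rewrite idx_s.
    by rewrite /sel idx_s os /=; do 2!case: (odd _).
  have rs : r (s v) = s v.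
    by rewrite r_s it eq -(ord_eq _ _ (rP v)) iter_order.
  split=> //; first by rewrite /sel (idx0 _ rs) os; case: (odd (order s v)).
  by rewrite /sel -eq /=; case: (odd (idx v)).
have sel_root v : r v = v -> sel v = ~~ odd (order s v).
  by move=> rv; rewrite /sel (idx0 _ rv); case: (odd (order s v)).
have sel_prev v : r (s v) = s v -> sel v = false.
  by case: (step v) => [[_ nr] /nr|[]].
have sel_st : sel (s t) = false.
  by have := sel_root _ rt; case: (step t) => [[-> _]|[_ _]] ->; rewrite even_t.
exists [set v | sel v & v != t]; split=> v; rewrite !inE.
  case/andP=> selv vt; apply/and3P; split.
  - by case: (step v) selv => [[-> _] ->|[_ _ ->]] //.
  - apply: contraL selv; rewrite (negPf vt) => /or4P[] /eqP // ->.
    + by rewrite sel_root // odd1.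
    + by rewrite sel_root // odd2.
    by rewrite sel_st.
  apply: contraL selv => /or4P[] /eqP sv.
  - by rewrite sel_prev // sv.
  - by rewrite sel_prev // sv.
  - by rewrite sel_prev // sv.
  by move: vt; rewrite (s_inj _ _ sv) eqxx.
rewrite !negb_or => /and4P[v1 v2 vt vst]; rewrite vt andbT.
have su : s (finv s v) = v := f_finv s_inj v.
have ut : finv s v != t by apply: contraNneq vst => <-; rewrite su.
case: (step (finv s v)); rewrite su.
  case=> [-> _]; case: (boolP (sel (finv s v))) => selu; last by left.
  by right; exists (finv s v); rewrite ?inE ?selu.
case=> rv -> _; left; apply: contraT; rewrite negbK.
have <- : order s v = order s (finv s v) by apply/esym/ord_eq; rewrite -{2}su fconnect1.
move/odd_orbits; rewrite -[X in fconnect s x1 X]rv -[X in fconnect s x2 X]rv.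
case: (boolP (fconnect s x1 v)) => [c1|nc1].
  by move: rv; rewrite /r c1 => xv; rewrite xv eqxx in v1.
case: (boolP (fconnect s x2 v)) => [c2|nc2].
  by move: rv; rewrite /r (negPf nc1) c2 => xv; rewrite xv eqxx in v2.
by rewrite !rv (negPf nc1) (negPf nc2).
Qed.

(* The matching consists of the edges leaving an alternating set for the successor
   permutation of the smooth orientation. *)
Lemma perfect_matching (V E : finType) (g : mgraph V E) (C N1 N2 W : {set E})
    (o : E -> bool) x1 x2 y1 y2 b :
  C \subset es g -> (forall v, degS g C v = 2) -> smooth_circuits g C o ->
  circuit g N1 -> N1 \subset C -> odd #|N1| ->
  circuit g N2 -> N2 \subset C -> odd #|N2| -> N1 != N2 ->
  (forall D, circuit g D -> D \subset C -> odd #|D| -> D = N1 \/ D = N2) ->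
  circuit g W -> W \subset C -> ~~ odd #|W| ->
  touches g N1 x1 -> touches g N2 x2 -> b \in W -> joins g b y1 y2 ->
  exists M, matching_in g C [set x1; y1; y2; x2] M /\
    forall v, v \notin [set x1; y1; y2; x2] -> touches g M v.
Proof.
move=> sC degC sm c1 s1 odd1 c2 s2 odd2 N12 odds cW sW evenW t1 t2 bW jb.
have reg v : touches g C v -> degS g C v = 2 by [].
have tC v : touches g C v by rewrite -degS_gt0 degC.
have [out outE] : exists out : V -> E,
    forall v, [set e in C | tail g o e == v] = [set out v].
  apply: (@fin_all_exists _ (fun=> E) (fun v e => [set f in C | tail g o f == v] = [set e])).
  by move=> v; apply/cards1P/eqP; case: (smooth_vertex reg sC sm (tC v)).
have outC v : (out v \in C) && (tail g o (out v) == v).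
  by have /setP/(_ (out v)) := outE v; rewrite !inE eqxx.
have out_tail e : e \in C -> out (tail g o e) = e.
  by move=> eC; have /setP/(_ e) := outE (tail g o e); rewrite !inE eC eqxx => /esym/eqP.
have tail_out v : tail g o (out v) = v by case/andP: (outC v) => _ /eqP.
have {}outC v : out v \in C by case/andP: (outC v).
pose s v := Defs.head g o (out v).
have s_tail e : e \in C -> s (tail g o e) = Defs.head g o e.
  by move=> eC; rewrite /s out_tail.
have s_inj : injective s.
  move=> u v suv; rewrite -(tail_out u) -(tail_out v).
  have [/eqP/cards1P[e inE1] _] := smooth_vertex reg sC sm (tC (s u)).
  have /set1P -> : out u \in [set e] by rewrite -inE1 inE outC /=.
  have /set1P -> // : out v \in [set e].
  by rewrite -inE1 inE outC /=; apply/eqP/esym.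
have symC := sym_connect_sym (@adj_sym _ _ g C); have symf := fconnect_sym s_inj.
(* The orbits of [s] are thus the vertex sets of the circuits of [C]. An edge traversed backwards is
   harmless because [s], being injective on a finite type, has symmetric reachability. *)
have conn u v : connect (adj g C) u v = fconnect s u v.
  apply/idP/idP; apply: connect_sub => {u v} u v.
    case/existsP=> e /andP[eC je].
    have := fconnect1 s (tail g o e); rewrite s_tail // /Defs.head /tail.
    case/joinsP: je => ->; case: (o e) => //=; by rewrite symf.
  move/eqP <-; apply: (incident_connect (outC u)); last exact: incident_head.
  by rewrite -{2}(tail_out u) incident_tail.
have comp_circ v : circuit g (component g C v) by apply: component_circuit.
have comp_touch v : touches g (component g C v) v by apply: component_touches.
have comp_card v : #|component g C v| = order s v.
  rewrite /order -(card_imset (fconnect s v) (can_inj tail_out)); apply: eq_card => e.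
  apply/idP/imsetP => [eD|[u vu ->]].
    have eC : e \in C by apply: subsetP eD; apply: component_sub.
    exists (tail g o e); last by rewrite out_tail.
    rewrite -[_ \in _]/(fconnect s v (tail g o e)) -conn.
    by rewrite -(component_incident _ eC) // incident_tail.
  rewrite (component_incident v (outC u) (u := u)) ?conn //.
  by rewrite -{2}(tail_out u) incident_tail.
have comp_eq D v : circuit g D -> D \subset C -> touches g D v -> component g C v = D.
  by move=> cD sD Dv; apply: (circuit_unique reg _ cD _ sD _ Dv) => //; apply: component_sub.
have conn_comp u v : fconnect s u v -> component g C u = component g C v.
  rewrite -conn => uv; apply/setP=> e; rewrite !inE; congr (_ && _).
  exact: (same_connect symC uv).
have comp_conn u v : component g C u = component g C v -> fconnect s u v.
  move=> eq_uv; have /touchesP[e eD ev] := comp_touch v.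
  rewrite -conn -(component_incident u _ ev) ?eq_uv //.
  exact: (subsetP (component_sub g C v)).
have E1 := comp_eq _ _ c1 s1 t1; have E2 := comp_eq _ _ c2 s2 t2.
(* With the tail of [b] as start, the dropped pair [t], [s t] consists of [y1] and [y2], whichever
   way [b] is oriented. *)
have bC := subsetP sW _ bW; set t := tail g o b.
have EW : component g C t = W.
  by apply: comp_eq => //; apply/touchesP; exists b; rewrite ?incident_tail.
have st : s t = Defs.head g o b := s_tail b bC.
have R_eq v : (v \in [set x1; y1; y2; x2]) = (v \in [:: x1; x2; t; s t]).
  rewrite st /t /Defs.head /tail !inE.
  by case/joinsP: jb => ->; case: (o b) => /=; do 4!case: (v == _).
have [||||v|A [A_alt A_cov]] := @alternating_set _ s x1 x2 t s_inj.
- by rewrite -comp_card E1.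
- by rewrite -comp_card E2.
- by apply: contra N12 => /conn_comp; rewrite E1 E2 => ->.
- by rewrite -comp_card EW.
- rewrite -comp_card => /(odds _ (comp_circ v) (component_sub g C v)).
  by rewrite -{1}E1 -{1}E2 => -[] /esym/comp_conn ->; rewrite ?orbT.
have inc u v : incident g (out u) v -> v = u \/ v = s u.
  rewrite -{2}(tail_out u) /s /Defs.head /tail /incident.
  by case: (o _) => /orP[] /eqP ->; auto.
exists (out @: A); split=> [|v]; last first.
  rewrite R_eq => /A_cov[vA|[u uA <-]]; apply/touchesP.
    by exists (out v); rewrite ?imset_f // -{2}(tail_out v) incident_tail.
  by exists (out u); rewrite ?imset_f ?incident_head.
split=> [|_ /imsetP[u uA ->]|_ _ v /imsetP[u uA ->] /imsetP[w wA ->] neq].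
- by apply/subsetP=> _ /imsetP[u _ ->].
- have /and3P[suA uR suR] := A_alt u uA; rewrite -!R_eq in uR suR.
  have u_su : u != s u by apply: contraNneq suA => <-.
  have := tail_out u; rewrite -/(s u) in suR u_su *; move: suR u_su.
  rewrite /s /tail /Defs.head; case: (o _) => sR us eu; rewrite eu ?uR ?sR.
    by rewrite us.
  by rewrite eq_sym us.
have [/and3P[suA _ _] /and3P[swA _ _]] := (A_alt u uA, A_alt w wA).
have uw : u != w by apply: contraNneq neq => ->.
case/inc=> ->; apply/negP => /inc[] eq.
- by rewrite eq eqxx in uw.
- by rewrite -eq uA in swA.
- by rewrite eq wA in suA.
by rewrite (s_inj _ _ eq) eqxx in uw.
Qed.

Lemma matching_degS (V E : finType) (g : mgraph V E) (C M : {set E}) R v :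
  matching_in g C R M -> degS g M v = touches g M v.
Proof.
move=> [_ ends_M disj]; case: (boolP (touches g M v)) => [/touchesP[e eM ev]|]; last first.
  by rewrite -degS_gt0 -leqNgt leqn0 => /eqP.
rewrite /degS (bigD1 e eM) big1 /= => [|f /andP[fM fe]].
  have [ne _ _] := ends_M _ eM; rewrite addn0; case/orP: ev => /eqP ev.
    by rewrite -ev eqxx [_ == (ends g e).1]eq_sym (negPf ne).
  by rewrite -ev eqxx (negPf ne).
apply/eqP; rewrite -leqn0 leqNgt degS_incident; apply: disj ev => //.
by rewrite eq_sym.
Qed.

(** A matching touches twice as many vertices as it has edges. The vertices touched by [M] are among
    those touched by [M'] and, by maximality, at least as many. *)
Lemma max_matching_covers (V E : finType) (g : mgraph V E) (C M M' : {set E}) R v :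
  max_matching_in g C R M -> matching_in g C R M' ->
  (forall w, w \notin R -> touches g M' w) -> v \notin R -> touches g M v.
Proof.
move=> [mM max] mM' cov vR; have le := max _ mM'.
have card_touched D : matching_in g C R D -> #|[set w | touches g D w]| = 2 * #|D|.
  move=> mD; have := sum_degS g D setT.
  rewrite (eq_bigr (fun w => touches g D w : nat)) => [|w _]; last exact: matching_degS mD.
  rewrite [RHS](eq_bigr (fun=> 2)) => [|e _]; last by rewrite !inE.
  rewrite sum_nat_const mulnC => <-; rewrite -sum1_card big_mkcond.
  by rewrite [RHS](eq_bigl xpredT); [apply: eq_bigr|]=> w; rewrite inE //; case: ifP.
have sub : [set w | touches g M w] \subset [set w | touches g M' w].
  apply/subsetP=> w; rewrite !inE => /touchesP[e eM ew]; apply: cov.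
  by case: mM => _ /(_ e eM)[_ e1 e2] _; case/orP: ew => /eqP <-.
have /setP/(_ v) : [set w | touches g M w] = [set w | touches g M' w].
  by apply/eqP; rewrite eqEcard sub !card_touched // leq_pmul2l.
by rewrite !inE cov.
Qed.

(** * Smoothing two edges *)

Section Joins.
Variables (V E : finType) (g : mgraph V E).

Lemma joins_deg e x y v : joins g e x y ->
  (((ends g e).1 == v) + ((ends g e).2 == v) = (x == v) + (y == v))%N.
Proof. by case/joinsP=> -> //=; rewrite addnC. Qed.

Local Open Scope ring_scope.

Lemma netin_joins e x u v : joins g e x u -> u != x -> x != v ->
  netin g e v = - (netin g e x * (u == v)%:Z).
Proof.
rewrite /netin => /joinsP[] -> /= /negPf ux /negPf xv; rewrite eqxx ux xv.
  by rewrite GRing.sub0r GRing.mulN1r GRing.opprK GRing.subr0.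
by rewrite GRing.subr0 GRing.mul1r GRing.sub0r.
Qed.

Lemma netin_ends e x y : joins g e x y -> y != x -> netin g e x = - netin g e y.
Proof.
rewrite /netin => /joinsP[] -> /= /negPf yx; by rewrite !eqxx [x == y]eq_sym yx.
Qed.

(** For a vertex off the path, the end edges [p] and [q] act like one edge from [u] to [w] carrying
    what enters through [p]. The case x = y is a single smoothed vertex; x and y differ for the path
    w1, y1, y2, w2. *)
Lemma through_path (phi : E -> int) p q x y u w v :
  joins g p x u -> joins g q y w -> u != x -> w != y -> x != v -> y != v ->
  phi p * netin g p x + phi q * netin g q y = 0 ->
  phi p * netin g p v + phi q * netin g q v =
  phi p * netin g p x * ((w == v)%:Z - (u == v)%:Z).
Proof.
move=> jp jq ux wy xv yv /eqP; rewrite GRing.addr_eq0 => /eqP pq.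
rewrite (netin_joins jp) // (netin_joins jq) // !GRing.mulrN !GRing.mulrA pq.
ring.
Qed.

End Joins.

Section Smoothing.
Variables (V E : finType) (en : E -> V * V).
Variables (x1 y1 x2 y2 u1 v1 u2 v2 w1 w2 : V) (a1 b a2 p1 q1 p2 q2 r1 r2 : E).
Let G := MGraph setT setT en.
Let G' := smooth2 en x1 y1 x2 y2 u1 v1 u2 v2 w1 w2.
Let R := [set x1; y1; x2; y2].

Hypothesis edges_uniq : uniq [:: a1; b; a2; p1; q1; p2; q2; r1; r2].
Hypothesis R_uniq : uniq [:: x1; y1; x2; y2].
Hypothesis star_x1 : forall e, incident G e x1 = (e \in [:: a1; p1; q1]).
Hypothesis star_x2 : forall e, incident G e x2 = (e \in [:: a2; p2; q2]).
Hypothesis star_y1 : forall e, incident G e y1 = (e \in [:: a1; b; r1]).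
Hypothesis star_y2 : forall e, incident G e y2 = (e \in [:: b; a2; r2]).
Hypotheses (join_a1 : joins G a1 x1 y1) (join_b : joins G b y1 y2)
  (join_a2 : joins G a2 y2 x2)
  (join_p1 : joins G p1 x1 u1) (join_q1 : joins G q1 x1 v1)
  (join_p2 : joins G p2 x2 u2) (join_q2 : joins G q2 x2 v2)
  (join_r1 : joins G r1 y1 w1) (join_r2 : joins G r2 y2 w2).
Hypotheses (u1R : u1 \notin R) (v1R : v1 \notin R) (u2R : u2 \notin R)
  (v2R : v2 \notin R) (w1R : w1 \notin R) (w2R : w2 \notin R).

Let es9 := [:: a1; b; a2; p1; q1; p2; q2; r1; r2].

Lemma es9_neq i j : i < 9 -> j < 9 -> i != j -> nth a1 es9 i != nth a1 es9 j.
Proof. by move=> i9 j9 ij; rewrite nth_uniq. Qed.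

Lemma es_smooth_inl f :
  (inl f \in es G') = (f \notin [:: a1; b; a2; p1; q1; p2; q2; r1; r2]).
Proof.
rewrite inE star_x1 star_x2 star_y1 star_y2 !inE.
by do 9!case: (f == _).
Qed.

Lemma es_smooth_inr i : inr i \in es G'.
Proof. by rewrite inE. Qed.

Lemma vs_smooth v : (v \in vs G') = (v \notin R).
Proof. by rewrite in_setC. Qed.

(** The values are in an arbitrary [nmodType] so that vertex degrees and net inflows can both be
    carried over to G'. *)
Lemma sum_smooth (A : nmodType) (h : E -> A) (h' : 'I_3 -> A) :
  (h a1 = 0 -> h b = 0 -> h a2 = 0 ->
   h p1 + h q1 = h' ord0 -> h p2 + h q2 = h' (inord 1) -> h r1 + h r2 = h' (inord 2) ->
   \sum_(e in es G) h e =
   \sum_(e in es G') match e with inl f => h f | inr i => h' i end)%R.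
Proof.
move=> ha1 hb ha2 h0 h1 h2; rewrite [RHS]big_mkcond big_sumType.
have -> : (\sum_(f : E) (if inl f \in es G' then h f else 0) =
    \sum_(f | f \notin [:: a1; b; a2; p1; q1; p2; q2; r1; r2]) h f)%R.
  by rewrite [RHS]big_mkcond; apply: eq_bigr => f _; rewrite es_smooth_inl.
rewrite (eq_bigr h') => [|i _]; last by rewrite es_smooth_inr.
rewrite [LHS](eq_bigl xpredT) => [|f]; last exact: in_setT.
rewrite [LHS](bigID (mem [:: a1; b; a2; p1; q1; p2; q2; r1; r2])) /= GRing.addrC.
congr (_ + _)%R; rewrite -big_uniq //= !big_cons big_nil ha1 hb ha2.
rewrite !GRing.add0r GRing.addr0 !big_ord_recl big_ord0 GRing.addr0 h2.
rewrite (GRing.addrA (h p2)) h1 (GRing.addrA (h p1)) h0.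
by congr (_ + (_ + _))%R; congr (h' _); apply/val_inj; rewrite /= inordK.
Qed.

Lemma big_star (A : nmodType) (h : E -> A) v (s : seq E) : uniq s ->
  (forall e, incident G e v = (e \in s)) -> (forall e, ~~ incident G e v -> h e = 0%R) ->
  (\sum_(e in es G) h e = \sum_(e <- s) h e)%R.
Proof.
move=> s_uniq star h0; rewrite big_uniq //= [RHS]big_mkcond.
rewrite (eq_bigl xpredT) => [|e]; last exact: in_setT.
by apply: eq_bigr => e _; case: ifP => // es_; rewrite h0 // star es_.
Qed.

Lemma smooth_cubic : cubic G -> cubic G'.
Proof.
move=> [_ deg3]; split=> [[f|i]|v].
- rewrite !vs_smooth es_smooth_inl => f9.
  have nR x : incident G f x -> x \notin R.
    apply: contraL; rewrite !inE -!orbA => /or4P[] /eqP ->;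
      rewrite ?star_x1 ?star_x2 ?star_y1 ?star_y2;
      by move: f9; rewrite !inE; do 9!case: (f == _).
  by split; apply: nR; rewrite /incident eqxx ?orbT.
- by rewrite !vs_smooth /=; case: ifP => _; [|case: ifP => _].
rewrite vs_smooth => vR; transitivity (degS G (es G) v); last exact: deg3 (in_setT v).
rewrite /degS; symmetry.
have [x1v y1v x2v y2v] : [/\ (x1 == v) = false, (y1 == v) = false,
    (x2 == v) = false & (y2 == v) = false].
  move: vR; rewrite !inE -!orbA !negb_or ![v == _]eq_sym.
  by case/and4P=> /negPf-> /negPf-> /negPf-> /negPf->.
rewrite (sum_smooth (h := fun e => ((ends G e).1 == v) + ((ends G e).2 == v))
  (h' := fun i => ((ends G' (inr i)).1 == v) + ((ends G' (inr i)).2 == v))).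
- by apply: eq_bigr => -[].
all: rewrite ?(joins_deg _ join_a1) ?(joins_deg _ join_b) ?(joins_deg _ join_a2)
  ?(joins_deg _ join_p1) ?(joins_deg _ join_q1) ?(joins_deg _ join_p2) ?(joins_deg _ join_q2)
  ?(joins_deg _ join_r1) ?(joins_deg _ join_r2) ?x1v ?y1v ?x2v ?y2v //=.
- by rewrite inordK.
- by rewrite inordK.
Qed.

Variable phi : E -> int.

(** A new edge has [u1], [u2] or [w1] as its first end, so its value is the flow that arrives
    through [p1], [p2] or [r1]. *)
Definition smooth_phi (e : E + 'I_3) : int :=
  match e with
  | inl f => phi f
  | inr i => if val i == 0 then phi p1 * netin G p1 x1 else
             if val i == 1 then phi p2 * netin G p2 x2 else phi r1 * netin G r1 y1
  end%R.

Hypotheses (phi_a1 : phi a1 = 0%R) (phi_a2 : phi a2 = 0%R) (flow : is_flow G phi).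

Lemma path_values :
  [/\ phi p1 * netin G p1 x1 + phi q1 * netin G q1 x1 = 0,
      phi p2 * netin G p2 x2 + phi q2 * netin G q2 x2 = 0,
      phi b * netin G b y2 = phi r1 * netin G r1 y1 &
      phi r1 * netin G r1 y1 + phi r2 * netin G r2 y2 = 0]%R.
Proof.
have netin0 e x : ~~ incident G e x -> (phi e * netin G e x = 0)%R.
  by rewrite /incident negb_or /netin => /andP[/negPf-> /negPf->]; rewrite GRing.mulr0.
(* Each star is presented as a mask of the nine edges, so that it inherits uniqueness from
   [edges_uniq]. *)
have flow_at x m : let s := mask m [:: a1; b; a2; p1; q1; p2; q2; r1; r2] in
    (forall e, incident G e x = (e \in s)) -> (\sum_(e <- s) phi e * netin G e x = 0)%R.
  move=> s st; rewrite -(big_star (mask_uniq edges_uniq m) st (netin0^~ x)).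
  exact: flow (in_setT x).
have fx1 := flow_at _ [:: true; false; false; true; true] star_x1.
have fx2 := flow_at _ [:: false; false; true; false; false; true; true] star_x2.
have fy1 := flow_at _ [:: true; true; false; false; false; false; false; true] star_y1.
have fy2 := flow_at _ [:: false; true; true; false; false; false; false; false; true] star_y2.
rewrite !big_cons !big_nil phi_a1 phi_a2 !GRing.mul0r !GRing.add0r !GRing.addr0
  in fx1 fx2 fy1 fy2.
have y12 : y2 != y1.
  by move: R_uniq; rewrite /= !inE !negb_or => /and4P[_ /andP[_ y12] _ _]; rewrite eq_sym.
split=> //; move: fy1 fy2; rewrite (netin_ends join_b y12) GRing.mulrN;
  move: (phi b * _)%R (phi r1 * _)%R (phi r2 * _)%R => B R1 R2; clear; lia.
Qed.

Lemma notin_R_neq x y : x \in R -> y \notin R -> (y != x) && (x != y).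
Proof. by move=> xR yR; rewrite [x == y]eq_sym andbb; apply: contraNneq yR => ->. Qed.

Lemma R_mem : [/\ x1 \in R, y1 \in R, x2 \in R & y2 \in R].
Proof. by rewrite !inE !eqxx !orbT. Qed.

Lemma smooth_is_flow : is_flow G' smooth_phi.
Proof.
move=> v; rewrite vs_smooth => vR.
have [f1 f2 _ f3] := path_values; have [x1R y1R x2R y2R] := R_mem.
have neq x y xR yR := elimT andP (@notin_R_neq x y xR yR).
have Rv x : x \in R -> x != v by move=> xR; case: (neq x v xR vR).
have sep x y : x \in R -> y \notin R -> y != x by move=> xR yR; case: (neq x y xR yR).
rewrite -[RHS](flow (in_setT v)) (sum_smooth (h := fun e => (phi e * netin G e v)%R)
  (h' := fun i => (smooth_phi (inr i) * netin G' (inr i) v)%R)).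
- by apply: eq_bigr => -[].
- by rewrite phi_a1 GRing.mul0r.
- have := Rv _ y1R; have := Rv _ y2R; rewrite /netin => /negPf y2v /negPf y1v.
  by case/joinsP: join_b => -> /=; rewrite y1v y2v GRing.subrr GRing.mulr0.
- by rewrite phi_a2 GRing.mul0r.
- by apply: through_path join_p1 join_q1 _ _ _ _ _; rewrite ?Rv ?sep.
- rewrite /smooth_phi /netin /= inordK //=.
  by apply: through_path join_p2 join_q2 _ _ _ _ _; rewrite ?Rv ?sep.
rewrite /smooth_phi /netin /= inordK //=.
by apply: through_path join_r1 join_r2 _ _ _ _ _; rewrite ?Rv ?sep.
Qed.

Lemma absz_smooth_phi i : absz (smooth_phi (inr i)) =
  absz (phi (if val i == 0 then p1 else if val i == 1 then p2 else r1)).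
Proof.
have [x1R y1R x2R y2R] := R_mem.
have unit e x u : joins G e x u -> x \in R -> u \notin R ->
    absz (phi e * netin G e x)%R = absz (phi e).
  move=> je xR uR; have /andP[/negPf ux _] := notin_R_neq xR uR.
  rewrite abszM /netin; case/joinsP: je => -> /=; rewrite eqxx ux.
    by rewrite muln1.
  by rewrite muln1.
by rewrite /=; case: ifP => _; [|case: ifP => _];
  [exact: unit join_p1 _ _|exact: unit join_p2 _ _|exact: unit join_r1 _ _].
Qed.

(** The boolean is true for the direction from [x] to [y]. Writing the edges along u1 x1 v1, along
    u2 x2 v2 and along w1 y1 y2 w2 lets one boolean serve a whole path. *)
Definition arc (o : E -> bool) e x y (d : bool) :=
  tail G o e = (if d then x else y) /\ Defs.head G o e = (if d then y else x).

Lemma arc_of_joins o e x y d : joins G e x y -> x != y ->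
  (Defs.head G o e == y) = d -> arc o e x y d.
Proof.
rewrite /arc /Defs.head /tail => /joinsP[] -> /= /negPf xy <-;
  by case: (o e); rewrite ?eqxx ?xy.
Qed.

(** * Lifting deletable edges from the smoothed graph *)

Section Lift.
Variables (o : E -> bool) (o' : E + 'I_3 -> bool) (d1 d2 d3 s : bool).
Hypothesis o'_inl : forall f, inl f \in es G' -> o' (inl f) = o f.
Hypotheses (o'_0 : forall i : 'I_3, val i = 0 -> o' (inr i) = d1)
  (o'_1 : forall i : 'I_3, val i = 1 -> o' (inr i) = d2)
  (o'_2 : forall i : 'I_3, val i = 2 -> o' (inr i) = d3).
Hypotheses (arc_p1 : arc o p1 u1 x1 d1) (arc_q1 : arc o q1 x1 v1 d1)
  (arc_p2 : arc o p2 u2 x2 d2) (arc_q2 : arc o q2 x2 v2 d2)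
  (arc_r1 : arc o r1 w1 y1 d3) (arc_b : arc o b y1 y2 d3) (arc_r2 : arc o r2 y2 w2 d3)
  (arc_a1 : arc o a1 x1 y1 s) (arc_a2 : arc o a2 y2 x2 s).

Definition linked (A : rel V) x :=
  (exists2 k, k \notin R & connect A k x) /\ (exists2 k, k \notin R & connect A x k).

(** A directed path of G' - [e'] is lifted arc by arc, new edges being replaced by paths of [A]; the
    [linked] hypotheses then attach the smoothed vertices in both directions. *)
Lemma lift_deletable e e' (A := darc G (es G :\ e) o) :
  deletable G' o' e' -> (forall f, inl f \in es G' -> f = e -> inl f = e') ->
  (forall i, inr i != e' -> connect A (tail G' o' (inr i)) (Defs.head G' o' (inr i))) ->
  linked A x1 -> linked A y1 -> linked A x2 -> linked A y2 -> deletable G o e.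
Proof.
move=> del' not_e paths lx1 ly1 lx2 ly2.
have arcs f : f != e -> A (tail G o f) (Defs.head G o f).
  by move=> fe; apply/existsP; exists f; rewrite !inE fe !eqxx.
have strong u v : u \notin R -> v \notin R -> connect A u v.
  case: (eqVneq u v) => [->|uv]; first by rewrite connect0.
  rewrite -!vs_smooth => uV vV; apply: connect_sub (del' u v uV vV uv) => x y.
  case/existsP=> -[f|i]; rewrite in_setD1 => /andP[/andP[fe' fE] /andP[/eqP <- /eqP <-]].
    apply: connect1; rewrite /tail /Defs.head o'_inl //; apply: arcs.
    by apply: contra fe' => /eqP/(not_e f fE) ->.
  exact: paths.
have link x : linked A x.
  case: (boolP (x \in R)) => [|xR]; last by split; exists x.
  by rewrite !inE -!orbA => /or4P[] /eqP ->.
move=> u v _ _ _; have [_ [k kR uk]] := link u; have [[l lR lv] _] := link v.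
exact: connect_trans (connect_trans uk (strong k l kR lR)) lv.
Qed.

Definition lifted_path (A : rel V) (i : nat) :=
  match i with
  | 0 => connect A (if d1 then u1 else v1) (if d1 then v1 else u1)
  | 1 => connect A (if d2 then u2 else v2) (if d2 then v2 else u2)
  | _ => connect A (if d3 then w1 else w2) (if d3 then w2 else w1)
  end.

Lemma lifted_pathP (A : rel V) (i : 'I_3) :
  lifted_path A i = connect A (tail G' o' (inr i)) (Defs.head G' o' (inr i)).
Proof.
case: i => [[|[|[|//]]] lt3]; rewrite /tail /Defs.head.
- by rewrite o'_0.
- by rewrite o'_1.
by rewrite o'_2.
Qed.

Lemma remaining_arc e f x y d : arc o f x y d -> f != e ->
  darc G (es G :\ e) o (if d then x else y) (if d then y else x).
Proof.
by case=> <- <- fe; apply/existsP; exists f; rewrite !inE fe !eqxx.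
Qed.

Ltac reach n :=
  match n with
  | S ?m => first
      [ exact: connect0
      | match goal with H : is_true (_ ?x _) |- is_true (connect _ ?x _) =>
          apply: (connect_trans (connect1 H)); reach m
        end ]
  end.

Ltac link_to := first [exists u1; [done|reach 5] | exists v1; [done|reach 5]
  | exists u2; [done|reach 5] | exists v2; [done|reach 5]
  | exists w1; [done|reach 5] | exists w2; [done|reach 5]].

(* The edges are numbered as in es9; k is the number of the deleted one. *)
Definition survives (A : rel V) (k i : nat) (x y : V) (d : bool) :=
  i != k -> A (if d then x else y) (if d then y else x).

Lemma survives_all k e : (forall i, i < 9 -> i != k -> nth a1 es9 i != e) ->
  let A := darc G (es G :\ e) o in
  [/\ survives A k 0 x1 y1 s, survives A k 1 y1 y2 d3 & survives A k 2 y2 x2 s] /\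
  [/\ survives A k 3 u1 x1 d1, survives A k 4 x1 v1 d1, survives A k 5 u2 x2 d2
    & survives A k 6 x2 v2 d2] /\
  survives A k 7 w1 y1 d3 /\ survives A k 8 y2 w2 d3.
Proof.
move=> ne A; have N i (i9 : i < 9) ik := ne i i9 ik.
split; first split=> ik.
- exact: remaining_arc arc_a1 (N 0 isT ik).
- exact: remaining_arc arc_b (N 1 isT ik).
- exact: remaining_arc arc_a2 (N 2 isT ik).
split; last first.
  split=> ik; first exact: remaining_arc arc_r1 (N 7 isT ik).
  exact: remaining_arc arc_r2 (N 8 isT ik).
split=> ik.
- exact: remaining_arc arc_p1 (N 3 isT ik).
- exact: remaining_arc arc_q1 (N 4 isT ik).
- exact: remaining_arc arc_p2 (N 5 isT ik).
exact: remaining_arc arc_q2 (N 6 isT ik).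
Qed.

(** The excluded edges are those that are alone in their direction at some vertex of [R]. For d1 =
    s, [q1] and [a1] both leave or both enter [x1], so [p1] must stay; for d3 = s, [b] is the only
    edge of its direction at [y1] and at [y2]. *)
Lemma connected_lift (A : rel V) k :
  [/\ survives A k 0 x1 y1 s, survives A k 1 y1 y2 d3 & survives A k 2 y2 x2 s] /\
  [/\ survives A k 3 u1 x1 d1, survives A k 4 x1 v1 d1, survives A k 5 u2 x2 d2
    & survives A k 6 x2 v2 d2] /\
  survives A k 7 w1 y1 d3 /\ survives A k 8 y2 w2 d3 ->
  k != (if d1 == s then 3 else 4) -> k != (if d2 == s then 6 else 5) ->
  (if d3 == s then k != 1 else (k != 7) && (k != 8)) ->
  [/\ linked A x1, linked A y1, linked A x2 & linked A y2] /\
  [/\ (k != 3) && (k != 4) -> lifted_path A 0, (k != 5) && (k != 6) -> lifted_path A 1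
    & (k != 1) && (k != 7) && (k != 8) -> lifted_path A 2].
Proof.
rewrite /survives /linked /lifted_path; case=> -[+ + +] [[+ + + +] [+ +]].
(* The last case of [k] stands for all numbers from 9 on, where no special edge is deleted. *)
by case: k => [|[|[|[|[|[|[|[|[|k]]]]]]]]]; case: d1; case: d2; case: d3; case: s => //=;
  do 9?[move=> /(_ isT) ? | move=> _]; move=> // _ _ _; do ![split] => //; try move=> _;
  first [reach 5 | link_to].
Qed.

Lemma lift_ordinary f : inl f \in es G' -> deletable G' o' (inl f) -> deletable G o f.
Proof.
(* The number 9 indexes none of the nine edges, so all of them survive. *)
move=> fE del'; have ne i : i < 9 -> i != 9 -> nth a1 es9 i != f.
  move=> i9 _; apply: contraTneq fE => <-.
  by rewrite es_smooth_inl negbK mem_nth.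
have [||//|[l1 l2 l3 l4] [P0 P1 P2]] := connected_lift (survives_all ne).
- by case: ifP.
- by case: ifP.
- by case: ifP.
apply: (lift_deletable del') => // [_ _ -> //|i _].
by rewrite -lifted_pathP; case: i => [[|[|[|//]]] lt3] /=; [apply: P0|apply: P1|apply: P2].
Qed.

(* An edge of a path smoothed into one edge can be removed if the dangling parts of
   the path remain attached in the right direction by a1 and a2. *)
Lemma lift_special k : k < 9 -> (forall i, deletable G' o' (inr i)) ->
  k != (if d1 == s then 3 else 4) -> k != (if d2 == s then 6 else 5) ->
  (if d3 == s then k != 1 else (k != 7) && (k != 8)) -> deletable G o (nth a1 es9 k).
Proof.
move=> k9 del' k1 k2 k3.
have ne i : i < 9 -> i != k -> nth a1 es9 i != nth a1 es9 k.
  by move=> i9 ik; rewrite nth_uniq.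
have [[l1 l2 l3 l4] [P0 P1 P2]] := connected_lift (survives_all ne) k1 k2 k3.
(* The new edge whose path is broken. Deleting [a1] or [a2] breaks no path, and the value 2 is then
   an arbitrary choice. *)
pose j := if (k == 3) || (k == 4) then 0 else if (k == 5) || (k == 6) then 1 else 2.
have j3 : j < 3 by rewrite /j; case: ifP => // _; case: ifP.
apply: (lift_deletable (del' (Ordinal j3))) => // [f fE ef|i ij].
  by move: fE; rewrite ef es_smooth_inl mem_nth.
have {}ij : val i != j by apply: contraNneq ij => ij; apply/eqP; congr inr; apply: val_inj.
rewrite -lifted_pathP; move: ij {j3}; rewrite /j => {j}.
case: i => [[|[|[|//]]] lt3] /= ij; [apply: P0|apply: P1|apply: P2]; move: k9 ij; clear;
  by case: k => [|[|[|[|[|[|[|[|[|k]]]]]]]]].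
Qed.

End Lift.

(* If s then a1 goes from x1 to y1 and a2 from y2 to x2, otherwise both are reversed. *)
Definition orient (s : bool) e :=
  if e == a1 then ((ends G a1).1 == x1) == s
  else if e == a2 then ((ends G a2).1 == y2) == s
  else (0 < phi e)%R.

Lemma head_sign (o : E -> bool) e x u : joins G e x u -> u != x -> phi e != 0%R ->
  o e = (0 < phi e)%R -> (Defs.head G o e == x) = (0 < phi e * netin G e x)%R.
Proof.
rewrite /Defs.head /netin => /joinsP[] -> /= /negPf ux nz ->; rewrite eqxx ux.
  rewrite GRing.sub0r GRing.mulrN1.
  by move: nz; case: ifP; rewrite ?eqxx ?ux; clear; lia.
by rewrite GRing.subr0 GRing.mulr1; case: ifP; rewrite ?eqxx ?ux.
Qed.

Hypothesis phi_neq0 : forall e, e != a1 -> e != a2 -> phi e != 0%R.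

Lemma smooth_phi_neq0 e : e \in es G' -> smooth_phi e != 0%R.
Proof.
case: e => [f|i] fE.
  have := fE; rewrite es_smooth_inl !inE !negb_or => /and3P[f1 _ /andP[f2 _]].
  exact: phi_neq0.
rewrite -absz_eq0 absz_smooth_phi absz_eq0.
case: ifP => _; [|case: ifP => _]; apply: phi_neq0.
- exact: (@es9_neq 3 0).
- exact: (@es9_neq 3 2).
- exact: (@es9_neq 5 0).
- exact: (@es9_neq 5 2).
- exact: (@es9_neq 7 0).
exact: (@es9_neq 7 2).
Qed.

Variable s : bool.
Let o := orient s.
Let o' e := (0 < smooth_phi e)%R.
Let d1 := (0 < phi p1 * netin G p1 x1)%R.
Let d2 := (0 < phi p2 * netin G p2 x2)%R.
Let d3 := (0 < phi r1 * netin G r1 y1)%R.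

Lemma orient_arcs :
  [/\ arc o a1 x1 y1 s, arc o b y1 y2 d3 & arc o a2 y2 x2 s] /\
  [/\ arc o p1 u1 x1 d1, arc o q1 x1 v1 d1, arc o p2 u2 x2 d2 & arc o q2 x2 v2 d2] /\
  arc o r1 w1 y1 d3 /\ arc o r2 y2 w2 d3.
Proof.
have [f1 f2 f3 f4] := path_values; have [x1R y1R x2R y2R] := R_mem.
have [xy1 xy2 y12] : [/\ x1 != y1, y2 != x2 & y1 != y2].
  move: R_uniq; rewrite /= !inE !negb_or => /and4P[/andP[-> _] /andP[_ ->] x2y2 _].
  by rewrite eq_sym.
have inner e x u (d : bool) : joins G e x u -> x \in R -> u \notin R -> e != a1 -> e != a2 ->
    (0 < phi e * netin G e x)%R = d -> arc o e u x d /\ arc o e x u (~~ d).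
  move=> je xR uR e1 e2 <-; have /andP[ux xu] := notin_R_neq xR uR.
  have hs := head_sign je ux (phi_neq0 e1 e2) (_ : o e = (0 < phi e)%R).
  have {}hs := hs (ltac:(by rewrite /o /orient (negPf e1) (negPf e2))).
  have je' : joins G e u x by rewrite /joins orbC.
  split; first exact: arc_of_joins.
  apply: arc_of_joins => //; rewrite -hs; move: je; clear -ux xu.
  by rewrite /Defs.head => /joinsP[] -> /=; case: (o e); rewrite eqxx ?(negPf ux) ?(negPf xu).
have nz (i : 'I_3) := smooth_phi_neq0 (es_smooth_inr i).
have n1 : (phi p1 * netin G p1 x1 != 0)%R := nz (@Ordinal 3 0 isT).
have n2 : (phi p2 * netin G p2 x2 != 0)%R := nz (@Ordinal 3 1 isT).
have n3 : (phi r1 * netin G r1 y1 != 0)%R := nz (@Ordinal 3 2 isT).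
have opp (A B : int) : (A + B = 0 -> A != 0 -> (0 < B) = ~~ (0 < A))%R by clear; lia.
split; first split.
- apply: arc_of_joins => //; rewrite /Defs.head /o /orient eqxx.
  have /negPf xy1' : y1 != x1 by rewrite eq_sym.
  by case/joinsP: join_a1 => -> /=; rewrite ?eqxx ?xy1';
    case: (s); rewrite /= ?eqxx ?(negPf xy1).
- apply: arc_of_joins => //.
  rewrite (head_sign (u := y1)) ?f3 //; first by rewrite /joins orbC.
    by apply: phi_neq0; [exact: (@es9_neq 1 0)|exact: (@es9_neq 1 2)].
  by rewrite /o /orient (negPf (@es9_neq 1 0 _ _ _)) // (negPf (@es9_neq 1 2 _ _ _)).
- apply: arc_of_joins => //; rewrite /Defs.head /o /orient (negPf (@es9_neq 2 0 _ _ _)) // eqxx.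
  have /negPf xy2' : x2 != y2 by rewrite eq_sym.
  by case/joinsP: join_a2 => -> /=; rewrite ?eqxx ?xy2';
    case: (s); rewrite /= ?eqxx ?(negPf xy2).
split; first split.
- by apply: (inner _ _ _ _ join_p1 _ _ (@es9_neq 3 0 _ _ _) (@es9_neq 3 2 _ _ _) _).1.
(* By conservation at [x1], [q1] leaves [x1] exactly when [p1] enters it. *)
- rewrite -[d1]negbK.
  apply: (inner _ _ _ _ join_q1 _ _ (@es9_neq 4 0 _ _ _) (@es9_neq 4 2 _ _ _) _).2 => //.
  exact: opp.
- by apply: (inner _ _ _ _ join_p2 _ _ (@es9_neq 5 0 _ _ _) (@es9_neq 5 2 _ _ _) _).1.
- rewrite -[d2]negbK.
  apply: (inner _ _ _ _ join_q2 _ _ (@es9_neq 6 0 _ _ _) (@es9_neq 6 2 _ _ _) _).2 => //.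
  exact: opp.
split; first by apply: (inner _ _ _ _ join_r1 _ _ (@es9_neq 7 0 _ _ _) (@es9_neq 7 2 _ _ _) _).1.
rewrite -[d3]negbK.
  apply: (inner _ _ _ _ join_r2 _ _ (@es9_neq 8 0 _ _ _) (@es9_neq 8 2 _ _ _) _).2 => //.
exact: opp.
Qed.

Lemma orient_inl f : inl f \in es G' -> o' (inl f) = o f.
Proof.
rewrite es_smooth_inl !inE !negb_or => /and3P[f1 _ /andP[f2 _]].
by rewrite /o' /o /orient (negPf f1) (negPf f2).
Qed.

Lemma orient_inr (i : 'I_3) :
  o' (inr i) = if val i == 0 then d1 else if val i == 1 then d2 else d3.
Proof. by rewrite /o' /=; case: ifP => //; case: ifP. Qed.

Lemma orient_deletable :
  (forall f, inl f \in es G' -> deletable G' o' (inl f) -> deletable G o f) /\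
  (forall k, k < 9 -> (forall i, deletable G' o' (inr i)) ->
   k != (if d1 == s then 3 else 4) -> k != (if d2 == s then 6 else 5) ->
   (if d3 == s then k != 1 else (k != 7) && (k != 8)) -> deletable G o (nth a1 es9 k)).
Proof.
have [[? ? ?] [[? ? ? ?] [? ?]]] := orient_arcs.
have inr_val (i : 'I_3) n : val i = n ->
    o' (inr i) = if n == 0 then d1 else if n == 1 then d2 else d3.
  by move=> <-; apply: orient_inr.
split=> [f|k k9 del' k1 k2 k3].
  apply: (@lift_ordinary o o' d1 d2 d3 s) => //; first exact: orient_inl.
  - by move=> i /inr_val.
  - by move=> i /inr_val.
  by move=> i /inr_val.
apply: (@lift_special o o' d1 d2 d3 s) => //; first exact: orient_inl.
- by move=> i /inr_val.
- by move=> i /inr_val.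
by move=> i /inr_val.
Qed.

End Smoothing.

(** * The theorem *)

Section Stars.
Variables (V E : finType) (g : mgraph V E).

Lemma degS_subset (D S : {set E}) v : D \subset S -> (degS g D v <= degS g S v)%N.
Proof. by move=> sDS; rewrite (degSID g S D) (setIidPr sDS) leq_addr. Qed.

Lemma card_le_degS (D : {set E}) v :
  (forall e, e \in D -> incident g e v) -> (#|D| <= degS g D v)%N.
Proof.
by move=> inc; rewrite -sum1_card; apply: leq_sum => e /inc; rewrite degS_incident.
Qed.

(** Three distinct edges at [x] use up its degree; a loop among them would count twice and give at
    least 4. *)
Lemma cubic_star x e1 e2 e3 : degS g setT x = 3 -> uniq [:: e1; e2; e3] ->
  all (fun e => incident g e x) [:: e1; e2; e3] ->
  (forall e, incident g e x = (e \in [:: e1; e2; e3])) /\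
  (forall e y, e \in [:: e1; e2; e3] -> joins g e x y -> y != x).
Proof.
move=> deg3 e_uniq /allP inc; set s := [:: e1; e2; e3] in e_uniq inc *.
have card_s : #|[set e in s]| = 3 by rewrite cardsE (card_uniqP e_uniq).
have le3 : (degS g setT x <= degS g [set e in s] x)%N.
  by rewrite deg3 -[X in (X <= _)%N]card_s card_le_degS // => e; rewrite inE => /inc.
split=> [e|e y es_ je].
  apply/idP/idP => [ex|/inc//].
  by have := degS_subset_eq (subsetT _) le3 (in_setT e) ex; rewrite inE.
have es' : e \in [set e in s] by rewrite inE.
have ge2 : (#|[set e in s] :\ e| <= degS g ([set e in s] :\ e) x)%N.
  by apply: card_le_degS => f; rewrite !inE => /andP[_ fs]; apply: inc; rewrite !inE.
have := degS_subset x (subsetT [set e in s]); rewrite deg3 {1}/degS (big_setD1 e es') /=.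
rewrite -/(degS g _ x) (joins_deg _ je) eqxx.
by move: ge2 card_s; rewrite (cardsD1 e [set e in s]) es'; case: (y == x) => //=; clear; lia.
Qed.

Lemma flow_of_smooth (S : {set E}) o :
  (forall w, touches g S w -> degS g S w = 2) -> S \subset es g ->
  smooth_circuits g S o -> is_flow g (fun e => if e \in S then orient_sign (o e) else 0%R).
Proof.
move=> reg sS sm v _; rewrite -[RHS](smooth_flow v reg sS sm).
rewrite [RHS]big_mkcond [LHS]big_mkcond; apply: eq_bigr => e _.
by case: (boolP (e \in S)) => eS; [rewrite (subsetP sS)|rewrite GRing.mul0r; case: ifP].
Qed.

Lemma is_flow_lin (a c : int) phi psi : is_flow g phi -> is_flow g psi ->
  is_flow g (fun e => a * phi e + c * psi e)%R.
Proof.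
move=> f1 f2 v vV; under eq_bigr do rewrite GRing.mulrDl -!GRing.mulrA.
by rewrite big_split /= -!GRing.mulr_sumr f1 // f2 // !GRing.mulr0.
Qed.

Lemma deletable_has_out o e x y : x \in vs g -> y \in vs g -> x != y ->
  deletable g o e -> exists f, [/\ f \in es g, f != e & tail g o f = x].
Proof.
move=> xV yV xy /(_ x y xV yV xy) /connectP[[|z p]] /=; first by move=> _ yx; rewrite yx eqxx in xy.
by case/andP=> /existsP[f]; rewrite in_setD1 => /andP[/andP[fe fE] /andP[/eqP fx _]] _ _; exists f.
Qed.

Lemma deletable_has_in o e x y : x \in vs g -> y \in vs g -> x != y ->
  deletable g o e -> exists f, [/\ f \in es g, f != e & Defs.head g o f = x].
Proof.
move=> xV yV xy del; have := del y x yV xV; rewrite eq_sym => /(_ xy) /connectP[p].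
case/lastP: p => [|p z] /=; first by move=> _ yx; rewrite yx eqxx in xy.
rewrite rcons_path last_rcons => /andP[_ /existsP[f]]; rewrite in_setD1.
by case/andP=> /andP[fe fE] /andP[_ /eqP fz] ->; exists f.
Qed.

(* Two of the three edges at x are both incoming or both outgoing; removing the
   third one leaves x without outgoing or without incoming edges. *)
Lemma fn_admits_ge2 x y e1 e2 e3 k : x \in vs g -> y \in vs g -> x != y ->
  e1 \in es g -> e2 \in es g -> e3 \in es g ->
  (forall e, incident g e x = (e \in [:: e1; e2; e3])) ->
  (forall e z, incident g e x -> joins g e x z -> z != x) ->
  (k < 2)%N -> ~ fn_admits g k.
Proof.
move=> xV yV xy E1 E2 E3 star noloop k2 [os del].
have [o {}del] : exists o, forall e, e \in es g -> deletable g o e.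
  case: k k2 os del => [|[|//]] _ os del; first by have [[]] := del e1 E1.
  by exists (os ord0) => e /del[i]; rewrite ord1.
have ends_x e : incident g e x -> (Defs.head g o e == x) = (tail g o e != x).
  move=> ex; have nl z := noloop e z ex; move: ex nl; rewrite /incident /joins.
  rewrite /Defs.head /tail; case: (ends g e) => z w /=.
  by case/orP=> /eqP->; [move/(_ w)|move/(_ z)]; rewrite eqxx ?orbT => /(_ isT) /negPf;
    case: (o e) => ->; rewrite eqxx.
have some_in e : e \in es g -> exists f, [/\ incident g f x, f != e & Defs.head g o f == x].
  move=> eE; have [f [fE fe fx]] := deletable_has_in xV yV xy (del e eE).
  by exists f; split=> //; rewrite -?fx ?incident_head.
have some_out e : e \in es g -> exists f, [/\ incident g f x, f != e & ~~ (Defs.head g o f == x)].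
  move=> eE; have [f [fE fe fx]] := deletable_has_out xV yV xy (del e eE).
  have ifx : incident g f x by rewrite -fx incident_tail.
  by exists f; split=> //; rewrite ends_x // negbK fx.
have has_other (P : pred E) e : (exists f, [/\ incident g f x, f != e & P f]) ->
    has (fun f => (f != e) && P f) [:: e1; e2; e3].
  by case=> f [fx fe Pf]; apply/hasP; exists f; rewrite -?star // fe.
have := has_other _ _ (some_out _ E3); have := has_other _ _ (some_in _ E3).
have := has_other _ _ (some_out _ E2); have := has_other _ _ (some_in _ E2).
have := has_other _ _ (some_out _ E1); have := has_other _ _ (some_in _ E1).
rewrite /= !eqxx /= !orbF; do 3!case: (Defs.head g o _ == x); rewrite /= ?andbF ?orbF //.
Qed.

End Stars.

(** Each [k] is excluded by at most one of the three conditions, and there for only one value of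
    [s]. *)
Lemma choose_orientation (d1 d2 d3 : bool) k : k < 9 -> exists s : bool,
  [/\ k != (if d1 == s then 3 else 4), k != (if d2 == s then 6 else 5) &
      if d3 == s then k != 1 else (k != 7) && (k != 8)].
Proof.
case: k => [|[|[|[|[|[|[|[|[|//]]]]]]]]] _; do 3?[case: d1 | case: d2 | case: d3];
  by first [by exists true | by exists false].
Qed.

Theorem theorem4 (V E : finType) (en : E -> V * V)
  (C N1 N2 W M : {set E}) (x1 y1 y2 x2 u1 v1 u2 v2 w1 w2 : V)
  (a1 b a2 p1 q1 p2 q2 r1 r2 : E) :
  let G := MGraph setT setT en in
  cubic G -> cyc_conn G 4 ->
  (* C is a 2-factor with exactly two odd circuits N1, N2, and an even circuit W *)
  two_factor G C ->
  circuit G N1 -> N1 \subset C -> odd #|N1| ->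
  circuit G N2 -> N2 \subset C -> odd #|N2| -> N1 != N2 ->
  (forall D, circuit G D -> D \subset C -> odd #|D| -> D = N1 \/ D = N2) ->
  circuit G W -> W \subset C -> ~~ odd #|W| ->
  (* edges x1y1, y1y2, y2x2 *)
  joins G a1 x1 y1 -> joins G b y1 y2 -> joins G a2 y2 x2 ->
  touches G N1 x1 -> touches G N2 x2 -> touches G W y1 -> touches G W y2 ->
  (* u_i, v_i: the two neighbours of x_i on N_i *)
  p1 \in N1 -> q1 \in N1 -> p1 != q1 -> joins G p1 x1 u1 -> joins G q1 x1 v1 ->
  p2 \in N2 -> q2 \in N2 -> p2 != q2 -> joins G p2 x2 u2 -> joins G q2 x2 v2 ->
  (* w_i: the neighbour of y_i on W different from y_{3-i} *)
  r1 \in W -> r1 != b -> joins G r1 y1 w1 -> w1 != y2 ->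
  r2 \in W -> r2 != b -> joins G r2 y2 w2 -> w2 != y1 ->
  (* M: maximum matching in C - {x1,y1,y2,x2} *)
  max_matching_in G C [set x1; y1; y2; x2] M ->
  let F := setT :\: C in
  let H := ((F :\: [set a1; a2]) :|: M) in
  let Z := Zset G N1 N2 W x1 x2 y1 y2 u1 v1 u2 v2 w1 w2 in
  let G' := smooth2 en x1 y1 x2 y2 u1 v1 u2 v2 w1 w2 in
  (* (i) *)
  (exists o1 o2 : E -> bool, [/\ smooth_circuits G H o1, smooth_circuits G C o2 &
                                 forall z, z \in Z -> o1 z = o2 z]) ->
  (* (ii) *)
  cyc_conn G' 3 ->
  (* (iii) *)
  ~ (exists (X : {set V}) (e1 e2 e3 : E + 'I_3),
       [/\ cycle_separating G' X, cut G' X = [set e1; e2; e3], #|cut G' X| = 3,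
           e1 \in [set inr i | i : 'I_3] &
           e2 \in [set inl f | f in H] /\ e3 \in [set inl f | f in H]]) ->
  fn_is G 2.
Proof.
move=> G cubG cyc4 [sC degC0] cN1 sN1 oN1 cN2 sN2 oN2 N12 odds cW sW eW ja1 jb ja2
  tx1 tx2 ty1 ty2 p1N q1N pq1 jp1 jq1 p2N q2N pq2 jp2 jq2 r1W r1b jr1 w1y2 r2W r2b jr2 w2y1
  maxM F H Z G' [o1 [o2 [sm1 sm2 agree]]] cyc3 no3.
have deg3 v : degS G setT v = 3 by apply: (cubG.2 v); rewrite in_setT.
have degC v : degS G C v = 2 by apply: degC0; rewrite in_setT.
have regC v : touches G C v -> degS G C v = 2 by [].
have closed (D : {set E}) e v : circuit G D -> D \subset C -> touches G D v -> e \in C ->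
    incident G e v -> e \in D by move=> cD sD; apply: (circuit_closed regC cD sD).
have same (D1 D2 : {set E}) v : circuit G D1 -> circuit G D2 -> D1 \subset C -> D2 \subset C ->
    touches G D1 v -> touches G D2 v -> D1 = D2 by apply: circuit_unique.
have touch (D : {set E}) e x y : joins G e x y -> e \in D -> touches G D y.
  by move=> /joins_incident/andP[_ ey] eD; apply/touchesP; exists e.
have N1W : N1 != W by apply: contraNneq eW => <-.
have N2W : N2 != W by apply: contraNneq eW => <-.
have apart (D1 D2 : {set E}) x y : circuit G D1 -> circuit G D2 -> D1 \subset C -> D2 \subset C ->
    D1 != D2 -> touches G D1 x -> touches G D2 y -> x != y.
  move=> c1 c2 s1 s2 + t1 t2; apply: contraNneq => xy.
  by apply/eqP/(same _ _ x); rewrite ?xy // -xy.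
have ap12 x y := @apart N1 N2 x y cN1 cN2 sN1 sN2 N12.
have ap1W x y := @apart N1 W x y cN1 cW sN1 sW N1W.
have ap2W x y := @apart N2 W x y cN2 cW sN2 sW N2W.
have inc1 e x y : joins G e x y -> incident G e x by move/joins_incident/andP => [].
have inc2 e x y : joins G e x y -> incident G e y by move/joins_incident/andP => [].
have jsym e x y : joins G e x y -> joins G e y x by rewrite /joins orbC.
have a1C : a1 \notin C.
  apply/negP=> a1C; have a1N := closed N1 a1 x1 cN1 sN1 tx1 a1C (inc1 _ _ _ ja1).
  by have := ap1W y1 y1 (touch _ _ _ _ ja1 a1N) ty1; rewrite eqxx.
have a2C : a2 \notin C.
  apply/negP=> a2C; have a2N := closed N2 a2 x2 cN2 sN2 tx2 a2C (inc2 _ _ _ ja2).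
  by have := ap2W y2 y2 (touch _ _ _ _ (jsym _ _ _ ja2) a2N) ty2; rewrite eqxx.
have inC (D : {set E}) e : D \subset C -> e \in D -> e \in C by move=> /subsetP; apply.
have neqC e f : e \notin C -> f \in C -> e != f by move=> eC fC; apply: contraNneq eC => ->.
have ends_eq e x y x' y' : joins G e x y -> joins G e x' y' -> x' = x \/ x' = y.
  by move=> /joinsP[] E1 /joinsP[]; rewrite E1 => -[-> ->]; auto.
have a1b : a1 != b.
  apply/eqP=> eq; have jb' := ja1; rewrite eq in jb'.
  have := ends_eq _ _ _ _ _ jb jb'; case=> x1y.
    by have := ap1W _ _ tx1 ty1; rewrite x1y eqxx.
  by have := ap1W _ _ tx1 ty2; rewrite x1y eqxx.
have a2b : a2 != b.
  apply/eqP=> eq; have jb' := ja2; rewrite eq in jb'.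
  have := ends_eq _ _ _ _ _ jb (jsym _ _ _ jb'); case=> x2y.
    by have := ap2W _ _ tx2 ty1; rewrite x2y eqxx.
  by have := ap2W _ _ tx2 ty2; rewrite x2y eqxx.
(* Otherwise [a1] and [b] are two edges off [C] at [y1], where [C] already takes two of the
   three. *)
have bC : b \in C.
  apply: contraT => bC; have := degSID G setT C y1; rewrite deg3 setTI degC.
  have : (degS G [set a1; b] y1 <= degS G (setT :\: C) y1)%N.
    by apply/degS_subset/subsetP=> e; rewrite !inE => /orP[] /eqP ->; rewrite ?a1C ?bC.
  have : (#|[set a1; b]| <= degS G [set a1; b] y1)%N.
    apply: card_le_degS => e; rewrite !inE => /orP[] /eqP ->.
      exact: inc2 ja1.
    exact: inc1 jb.
  by rewrite cards2 a1b; clear; lia.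
have bW : b \in W := closed W b y1 cW sW ty1 bC (inc1 _ _ _ jb).
have disj (D1 D2 : {set E}) e f : circuit G D1 -> circuit G D2 -> D1 \subset C ->
    D2 \subset C -> D1 != D2 -> e \in D1 -> f \in D2 -> e != f.
  move=> c1 c2 s1 s2 ne e1 f2; apply/eqP=> ef.
  have t x (D : {set E}) : e \in D -> incident G e x -> touches G D x.
    by move=> eD ex; apply/touchesP; exists e.
  have := apart _ _ _ _ c1 c2 s1 s2 ne (t _ _ e1 (incident1 G e)) (t _ D2 _ (incident1 G e)).
  by rewrite eqxx ef => /(_ f2).
have d12 e f := @disj N1 N2 e f cN1 cN2 sN1 sN2 N12.
have d1W e f := @disj N1 W e f cN1 cW sN1 sW N1W.
have d2W e f := @disj N2 W e f cN2 cW sN2 sW N2W.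
have [p1C q1C p2C q2C] : [/\ p1 \in C, q1 \in C, p2 \in C & q2 \in C].
  by split; [apply: inC p1N|apply: inC q1N|apply: inC p2N|apply: inC q2N].
have [r1C r2C] : r1 \in C /\ r2 \in C by split; [apply: inC r1W|apply: inC r2W].
have [star_x1 nl_x1] : (forall e, incident G e x1 = (e \in [:: a1; p1; q1])) /\
    (forall e y, e \in [:: a1; p1; q1] -> joins G e x1 y -> y != x1).
  apply: cubic_star => //; first by rewrite /= !inE negb_or pq1 !neqC.
  by rewrite /= (inc1 _ _ _ ja1) (inc1 _ _ _ jp1) (inc1 _ _ _ jq1).
have [star_x2 nl_x2] : (forall e, incident G e x2 = (e \in [:: a2; p2; q2])) /\
    (forall e y, e \in [:: a2; p2; q2] -> joins G e x2 y -> y != x2).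
  apply: cubic_star => //; first by rewrite /= !inE negb_or pq2 !neqC.
  by rewrite /= (inc2 _ _ _ ja2) (inc1 _ _ _ jp2) (inc1 _ _ _ jq2).
have [star_y1 nl_y1] : (forall e, incident G e y1 = (e \in [:: a1; b; r1])) /\
    (forall e y, e \in [:: a1; b; r1] -> joins G e y1 y -> y != y1).
  apply: cubic_star => //; first by rewrite /= !inE negb_or a1b [b == r1]eq_sym r1b neqC.
  by rewrite /= (inc2 _ _ _ ja1) (inc1 _ _ _ jb) (inc1 _ _ _ jr1).
have [star_y2 nl_y2] : (forall e, incident G e y2 = (e \in [:: b; a2; r2])) /\
    (forall e y, e \in [:: b; a2; r2] -> joins G e y2 y -> y != y2).
  apply: cubic_star => //.
    by rewrite /= !inE negb_or [b == a2]eq_sym a2b [b == r2]eq_sym r2b neqC.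
  by rewrite /= (inc2 _ _ _ jb) (inc1 _ _ _ ja2) (inc1 _ _ _ jr2).
have y12 : y2 != y1 by apply: nl_y1 jb; rewrite !inE eqxx orbT.
have a12 : a1 != a2.
  apply/eqP=> eq; have ja2' := jsym _ _ _ ja2; rewrite -eq in ja2'.
  case: (ends_eq _ _ _ _ _ ja1 ja2') => x2_eq.
    by have := ap12 _ _ tx1 tx2; rewrite x2_eq eqxx.
  by have := ap2W _ _ tx2 ty1; rewrite x2_eq eqxx.
have r12 : r1 != r2.
  apply/eqP=> eq; have jr2' := jr2; rewrite -eq in jr2'.
  by case: (ends_eq _ _ _ _ _ jr1 jr2') => y2_eq; [move: y12|move: w1y2]; rewrite y2_eq eqxx.
have edges_uniq : uniq [:: a1; b; a2; p1; q1; p2; q2; r1; r2].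
  have bp1 : b != p1 by rewrite eq_sym d1W.
  have bq1 : b != q1 by rewrite eq_sym d1W.
  have bp2 : b != p2 by rewrite eq_sym d2W.
  have bq2 : b != q2 by rewrite eq_sym d2W.
  have ba2 : b != a2 by rewrite eq_sym.
  have br1 : b != r1 by rewrite eq_sym.
  have br2 : b != r2 by rewrite eq_sym.
  rewrite /= !inE !negb_or a1b a12 ba2 pq1 pq2 r12 br1 br2 bp1 bq1 bp2 bq2 !(neqC a1) //.
  by rewrite !(neqC a2) // (d12 p1 p2) // (d12 p1 q2) // (d12 q1 p2) // (d12 q1 q2) //
    (d1W p1 r1) // (d1W p1 r2) // (d1W q1 r1) // (d1W q1 r2) //
    (d2W p2 r1) // (d2W p2 r2) // (d2W q2 r1) // (d2W q2 r2).
have R_uniq : uniq [:: x1; y1; x2; y2].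
  by rewrite /= !inE !negb_or (ap12 x1 x2) // (ap1W x1 y1) // (ap1W x1 y2) // (ap2W x2 y2) //
    [y1 == x2]eq_sym (ap2W x2 y1) // [y1 == y2]eq_sym y12.
pose R := [set x1; y1; x2; y2].
have notR x : x != x1 -> x != y1 -> x != x2 -> x != y2 -> x \notin R.
  by rewrite !inE !negb_or => -> -> -> ->.
have u1R : u1 \notin R.
  have t := touch _ _ _ _ jp1 p1N.
  apply: notR; [|exact: ap1W|exact: ap12|exact: ap1W].
  by apply: nl_x1 jp1; rewrite !inE eqxx orbT.
have v1R : v1 \notin R.
  have t := touch _ _ _ _ jq1 q1N.
  apply: notR; [|exact: ap1W|exact: ap12|exact: ap1W].
  by apply: nl_x1 jq1; rewrite !inE eqxx !orbT.
have u2R : u2 \notin R.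
  have t := touch _ _ _ _ jp2 p2N.
  apply: notR; [by rewrite eq_sym; apply: ap12|exact: ap2W| |exact: ap2W].
  by apply: nl_x2 jp2; rewrite !inE eqxx orbT.
have v2R : v2 \notin R.
  have t := touch _ _ _ _ jq2 q2N.
  apply: notR; [by rewrite eq_sym; apply: ap12|exact: ap2W| |exact: ap2W].
  by apply: nl_x2 jq2; rewrite !inE eqxx !orbT.
have w1R : w1 \notin R.
  have t := touch _ _ _ _ jr1 r1W.
  apply: notR => //; rewrite 1?[_ == x1]eq_sym 1?[_ == x2]eq_sym; [exact: ap1W| |exact: ap2W].
  by apply: nl_y1 jr1; rewrite !inE eqxx !orbT.
have w2R : w2 \notin R.
  have t := touch _ _ _ _ jr2 r2W.
  apply: notR => //; rewrite 1?[_ == x1]eq_sym 1?[_ == x2]eq_sym; [exact: ap1W|exact: ap2W|].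
  by apply: nl_y2 jr2; rewrite !inE eqxx !orbT.
set nine := [:: a1; b; a2; p1; q1; p2; q2; r1; r2] in edges_uniq.
have es_inl f : (inl f \in es G') = (f \notin nine) by apply: es_smooth_inl.
have eqR x : (x \in [set x1; y1; y2; x2]) = (x \in R).
  by rewrite !inE; do 4!case: (x == _).
have mM := maxM.1.
have coverM v : v \notin R -> touches G M v.
  have [M' [mM' covM']] := perfect_matching sC degC sm2 cN1 sN1 oN1 cN2 sN2 oN2 N12
    odds cW sW eW tx1 tx2 bW jb.
  by rewrite -eqR => vR; apply: max_matching_covers maxM mM' covM' vR.
have inR e x : x \in R -> incident G e x -> e \in nine.
  rewrite !inE -!orbA => /or4P[] /eqP ->; rewrite ?star_x1 ?star_x2 ?star_y1 ?star_y2 !inE;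
    by case/or3P=> ->; rewrite ?orbT.
have M_R e x : e \in M -> incident G e x -> x \notin R.
  by case: mM => _ endsM _ /endsM[_]; rewrite !eqR => e1 e2 /orP[] /eqP <-.
have M_C e : e \in M -> e \in C by case: mM => /subsetP sMC _ _; apply: sMC.
have M_nine e : e \in M -> e \notin nine.
  move=> eM; have nR x : x \in R -> incident G e x = false.
    by move=> xR; apply: contraTF xR; apply: M_R.
  have [x1R y1R x2R y2R] : [/\ x1 \in R, y1 \in R, x2 \in R & y2 \in R].
    by rewrite !inE !eqxx !orbT.
  by rewrite -es_inl inE !nR.
have H_nine e : e \in H -> e \notin nine.
  rewrite in_setU => /orP[|/M_nine//]; rewrite !inE negb_or => /andP[/andP[ea1 ea2] eC].
  rewrite (negPf ea1) (negPf ea2) /=; apply: contra (andP eC).1 => e9.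
  have: all (mem C) [:: b; p1; q1; p2; q2; r1; r2].
    by rewrite /= bC p1C q1C p2C q2C r1C r2C.
  by move/allP; apply; rewrite !inE.
have H_R e x : e \in H -> incident G e x -> x \notin R.
  by move=> /H_nine + ex; apply: contra => xR; apply: inR ex.
(* Off [R] a vertex has one edge of [F], which is neither [a1] nor [a2], and one edge of [M];
   vertices of [R] are not touched by [H]. *)
have H_reg v : touches G H v -> degS G H v = 2.
  case/touchesP=> e /H_R eR /eR vR {e eR}.
  have HM : H :&: M = M by apply/setIidPr/subsetUr.
  have HF : H :\: M = F :\: [set a1; a2].
    apply/setP=> e; rewrite !inE; case: (boolP (e \in M)) => //= [/M_C ->|]; rewrite ?orbF //.
    by rewrite andbF.
  rewrite (degSID G H M) HM HF (matching_degS v mM) (coverM v vR).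
  have := degSID G setT C v; rewrite deg3 setTI degC -/F (degSID G F [set a1; a2]).
  suff -> : degS G (F :&: [set a1; a2]) v = 0 by clear; lia.
  apply/eqP; rewrite -leqn0 leqNgt degS_gt0; apply: contra vR => /touchesP[e].
  rewrite !inE => /andP[_ /orP[] /eqP ->].
    by case/joinsP: ja1 => E1; rewrite /incident E1 /= => /orP[] /eqP ->; rewrite eqxx ?orbT.
  by case/joinsP: ja2 => E1; rewrite /incident E1 /= => /orP[] /eqP ->; rewrite eqxx ?orbT.
pose phi1 e : int := if e \in H then orient_sign (o1 e) else 0%R.
pose phi2 e : int := if e \in C then orient_sign (o2 e) else 0%R.
have flow1 : is_flow G phi1 by apply: flow_of_smooth => //; apply: subsetT.
have flow2 : is_flow G phi2 by apply: flow_of_smooth.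
pose phiA e : int := (1 * phi1 e + 2 * phi2 e)%R.
pose phiB e : int := (-2 * phi1 e + 1 * phi2 e)%R.
have flowA : is_flow G phiA by apply: is_flow_lin.
have flowB : is_flow G phiB by apply: is_flow_lin.
have cover e : e != a1 -> e != a2 -> (e \in H) || (e \in C).
  by move=> ea1 ea2; rewrite !inE (negPf ea1) (negPf ea2); case: (e \in C); rewrite ?orbT.
have [valHC valH valC] : [/\ forall e, e \in H -> e \in C ->
      if o1 e == o2 e then absz (phiA e) = 3 /\ absz (phiB e) = 1
      else absz (phiA e) = 1 /\ absz (phiB e) = 3,
    forall e, e \in H -> e \notin C -> absz (phiA e) = 1 /\ absz (phiB e) = 2 &
    forall e, e \notin H -> e \in C -> absz (phiA e) = 2 /\ absz (phiB e) = 1].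
  rewrite /phiA /phiB /phi1 /phi2 /orient_sign.
  by split=> e; [move=> -> ->|move=> -> /negPf ->|move=> /negPf -> ->]; case: (o1 e); case: (o2 e).
have nine_H e : e \in nine -> e \notin H by move=> e9; apply: contraL e9; apply: H_nine.
have phi_a a : a \in nine -> a \notin C -> phiA a = 0%R /\ phiB a = 0%R.
  by move=> /nine_H/negPf aH /negPf aC; rewrite /phiA /phiB /phi1 /phi2 aH aC.
have [A_a1 B_a1] : phiA a1 = 0%R /\ phiB a1 = 0%R by apply: phi_a; rewrite // !inE eqxx.
have [A_a2 B_a2] : phiA a2 = 0%R /\ phiB a2 = 0%R.
  by apply: phi_a; rewrite // !inE eqxx !orbT.
have phi_neq0 e : e != a1 -> e != a2 -> phiA e != 0%R /\ phiB e != 0%R.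
  move=> ea1 ea2; rewrite -!absz_eq0; have := cover e ea1 ea2.
  case: (boolP (e \in H)) => eH; case: (boolP (e \in C)) => eC //= _.
  - by have := valHC e eH eC; case: ifP => _ [-> ->].
  - by have [-> ->] := valH e eH eC.
  by have [-> ->] := valC e eH eC.
have nzA e ea1 ea2 := (phi_neq0 e ea1 ea2).1; have nzB e ea1 ea2 := (phi_neq0 e ea1 ea2).2.
have cubG' : cubic G' := smooth_cubic edges_uniq star_x1 star_x2 star_y1 star_y2 ja1 jb ja2
  jp1 jq1 jp2 jq2 jr1 jr2 u1R v1R u2R v2R w1R w2R cubG.
have conn3 X := @cyc_conn3_cut _ _ G' X cubG' cyc3.
pose sp := smooth_phi en x1 y1 x2 p1 p2 r1.
have sp_flow phi : phi a1 = 0%R -> phi a2 = 0%R -> is_flow G phi -> is_flow G' (sp phi).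
  exact: (smooth_is_flow edges_uniq R_uniq star_x1 star_x2 star_y1 star_y2 jb
    jp1 jq1 jp2 jq2 jr1 jr2 u1R v1R u2R v2R w1R w2R).
have sp_neq0 phi : (forall e, e != a1 -> e != a2 -> phi e != 0%R) ->
    forall e, e \in es G' -> sp phi e != 0%R.
  exact: (smooth_phi_neq0 edges_uniq star_x1 star_x2 star_y1 star_y2
    jp1 jp2 jr1 u1R u2R w1R).
have sp_abs phi i : absz (sp phi (inr i)) =
    absz (phi (if val i == 0 then p1 else if val i == 1 then p2 else r1)).
  exact: (absz_smooth_phi jp1 jp2 jr1 u1R u2R w1R).
have [p1H p2H r1H] : [/\ p1 \notin H, p2 \notin H & r1 \notin H].
  by split; apply: nine_H; rewrite !inE eqxx !orbT.
have sp_absA i : absz (sp phiA (inr i)) = 2.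
  rewrite sp_abs; case: ifP => _; first by have [] := valC p1 p1H p1C.
  by case: ifP => _; [have [] := valC p2 p2H p2C|have [] := valC r1 r1H r1C].
have sp_absB i : absz (sp phiB (inr i)) = 1.
  rewrite sp_abs; case: ifP => _; first by have [] := valC p1 p1H p1C.
  by case: ifP => _; [have [] := valC p2 p2H p2C|have [] := valC r1 r1H r1C].
have del1 phi e : phi a1 = 0%R -> phi a2 = 0%R -> is_flow G phi ->
    (forall f, f != a1 -> f != a2 -> phi f != 0%R) -> absz (sp phi e) = 1 ->
    deletable G' (fun f => 0 < sp phi f)%R e.
  move=> h1 h2 fl nz v1_; apply: deletable_flow; rewrite ?v1_ //; first by case: cubG'.
  - exact: sp_neq0.
  exact: sp_flow.
(* An edge of [M] avoids [R], so at an end of a new edge it satisfies all conditions of [Zset]; the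
   circuit is the right one because circuits of [C] are closed under incidence. *)
have M_Z m i v : m \in M -> (v == (ends G' (inr i)).1) || (v == (ends G' (inr i)).2) ->
    incident G m v -> m \in Z.
  move=> mM_ vi mv; have mC := M_C m mM_.
  have mR x : x \in R -> incident G m x = false.
    by move=> xR; apply: contraTF xR; apply: M_R.
  have [x1R y1R x2R y2R] : [/\ x1 \in R, y1 \in R, x2 \in R & y2 \in R].
    by rewrite !inE !eqxx !orbT.
  rewrite !inE (mR x1) ?(mR y1) ?(mR x2) ?(mR y2) //=; move: vi; rewrite /= ?andbT.
  case: (val i == 0) => /=; [|case: (val i == 1) => /=].
  - case/orP=> /eqP v_eq; rewrite -v_eq mv ?orbT !andbT.
      by rewrite (closed N1 m v cN1 sN1 _ mC mv) // v_eq; apply: touch jp1 p1N.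
    by rewrite (closed N1 m v cN1 sN1 _ mC mv) // v_eq; apply: touch jq1 q1N.
  - case/orP=> /eqP v_eq; rewrite -v_eq mv ?orbT !andbT.
      by rewrite (closed N2 m v cN2 sN2 _ mC mv) ?orbT // v_eq; apply: touch jp2 p2N.
    by rewrite (closed N2 m v cN2 sN2 _ mC mv) ?orbT // v_eq; apply: touch jq2 q2N.
  case/orP=> /eqP v_eq; rewrite -v_eq mv ?orbT !andbT.
    by rewrite (closed W m v cW sW _ mC mv) ?orbT // v_eq; apply: touch jr1 r1W.
  by rewrite (closed W m v cW sW _ mC mv) ?orbT // v_eq; apply: touch jr2 r2W.
(* Edges of [C] outside [H] have value 2 under [phiA]. This places the two edges of value 1 of a
   critical cut in the set that (iii) requires. *)
have light f : inl f \in es G' -> absz (phiA f) = 1 -> f \in H.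
  rewrite es_inl => f9 vf; apply: contraT => fH.
  have [fa1 fa2] : f != a1 /\ f != a2 by move: f9; rewrite !inE !negb_or => /and3P[-> _ /andP[->]].
  have := cover f fa1 fa2; rewrite (negPf fH) /= => fC.
  by have [] := valC f fH fC; rewrite vf.
(* A 3-cut around a single end of a smoothed edge contains an edge of Z, of value 3. *)
have no_star i e2 e3 (Y : {set V}) : Y \subset vs G' -> Y != set0 ->
    cut G' Y = [set inr i; e2; e3] -> #|cut G' Y| = 3 ->
    absz (sp phiA e2) = 1 -> absz (sp phiA e3) = 1 -> ~ has_cycle G' Y -> False.
  move=> sY Y0 eqY c3 v2_ v3_ acyc; have := acyclic_cut sY cubG'.2 Y0 acyc.
  rewrite c3 => le; have /cards1P[v Yv] : #|Y| == 1 by move: Y0 le; rewrite -card_gt0; clear; lia.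
  have vR : v \notin R.
    by have := subsetP sY v; rewrite Yv in_set1 eqxx vs_smooth => /(_ isT).
  have /touchesP[m m_M mv] := coverM v vR.
  have iY : inr i \in cut G' Y by rewrite eqY !inE eqxx.
  have vi : (v == (ends G' (inr i)).1) || (v == (ends G' (inr i)).2).
    move: iY; rewrite Yv !inE ![v == _]eq_sym /=.
    by case: (_ == v); case: (_ == v).
  have mY : inl m \in cut G' Y.
    rewrite inE es_inl M_nine //= Yv !inE; have [_ endsM _] := mM.
    have [ne _ _] := endsM m m_M; move: mv; rewrite /incident /=.
    by case/orP=> /eqP <-; rewrite eqxx; [rewrite [_ == (en m).1]eq_sym|]; rewrite (negPf ne).
  have := valHC m _ (M_C m m_M); rewrite (agree m (M_Z m i v m_M vi mv)) eqxx in_setU m_M orbT.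
  case=> // vm _; move: mY; rewrite eqY !inE => /orP[/eqP e2m|/eqP e3m].
    by move: v2_; rewrite -e2m /= vm.
  by move: v3_; rewrite -e3m /= vm.
have delA i : deletable G' (fun f => 0 < sp phiA f)%R (inr i).
  apply: deletable_flow => //; first by case: cubG'.
  - exact: sp_neq0.
  - exact: sp_flow.
  - by rewrite sp_absA.
  move=> X e2 e3 sX X0 XV eqX c3 val2 val3; exfalso.
  have inlH e : e \in cut G' X -> absz (sp phiA e) = 1 -> e \in [set inl f | f in H].
    case: e => [f|j]; last by rewrite sp_absA.
    by rewrite inE => /andP[fE _] vf; apply: imset_f; apply: light.
  (* Neither side can be acyclic, so the cut is cycle-separating and contradicts (iii). *)
  apply: (no_star i e2 e3 X) => // cX; apply: (no_star i e2 e3 (vs G' :\: X)) => //.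
  - exact: subsetDl.
  - by rewrite setD_eq0; apply: contra XV => sVX; rewrite eqEsubset sX.
  - by rewrite cut_compl //; case: cubG'.
  - by rewrite cut_compl //; case: cubG'.
  move=> cXc; apply: no3; exists X, (inr i), e2, e3; split=> //.
    by apply/imsetP; exists i.
  by split; apply: inlH; rewrite // eqX !inE eqxx ?orbT.
have delB i : deletable G' (fun f => 0 < sp phiB f)%R (inr i) by apply: del1.
have [ordA spcA] := orient_deletable edges_uniq R_uniq star_x1 star_x2 star_y1 star_y2
  ja1 jb ja2 jp1 jq1 jp2 jq2 jr1 jr2 u1R v1R u2R v2R w1R w2R A_a1 A_a2 flowA nzA true.
have [ordB spcB] := orient_deletable edges_uniq R_uniq star_x1 star_x2 star_y1 star_y2
  ja1 jb ja2 jp1 jq1 jp2 jq2 jr1 jr2 u1R v1R u2R v2R w1R w2R B_a1 B_a2 flowB nzB false.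
(* Outside [H] the flows are 2 phi2 and phi2, so the smoothed paths have the same directions under
   both. The booleans d1, d2, d3 are therefore common, and only [s] distinguishes the two
   orientations on the nine edges. *)
have same_dir e x : e \notin H -> e \in C ->
    (0 < phiA e * netin G e x)%R = (0 < phiB e * netin G e x)%R.
  move=> /negPf eH eC; rewrite /phiA /phiB /phi1 eH !GRing.mulr0 !GRing.add0r GRing.mul1r.
  by rewrite -GRing.mulrA Num.Theory.pmulr_rgt0.
split; last first.
  move=> j j2; apply: (@fn_admits_ge2 _ _ G x1 y1 a1 p1 q1); rewrite ?in_setT //.
    exact: ap1W.
  by move=> e z; rewrite star_x1; apply: nl_x1.
exists (fun i : 'I_2 => if val i == 0 then orient en x1 y2 a1 a2 phiA true
                        else orient en x1 y2 a1 a2 phiB false) => e _.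
suff: deletable G (orient en x1 y2 a1 a2 phiA true) e \/
      deletable G (orient en x1 y2 a1 a2 phiB false) e.
  by case=> del; [exists ord0|exists ord_max].
case: (boolP (e \in nine)) => [e9|eN9].
  have k9 : index e nine < 9 by rewrite index_mem.
  pose d r x := (0 < phiB r * netin G r x)%R.
  have [s [k1 k2 k3]] := choose_orientation (d p1 x1) (d p2 x2) (d r1 y1) k9.
  rewrite -(nth_index a1 e9); case: s k1 k2 k3 => k1 k2 k3; [left|right].
    by apply: spcA => //; rewrite same_dir.
  exact: spcB.
have fE : inl e \in es G' by rewrite es_inl.
have [ea1 ea2] : e != a1 /\ e != a2.
  by move: eN9; rewrite !inE !negb_or => /and3P[-> _ /andP[->]].
have [vA|vB] : absz (phiA e) = 1 \/ absz (phiB e) = 1.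
- have := cover e ea1 ea2; case: (boolP (e \in H)) => eH; case: (boolP (e \in C)) => eC //= _.
  + by have := valHC e eH eC; case: ifP => _ []; auto.
  + by have [] := valH e eH eC; auto.
  by have [] := valC e eH eC; auto.
- by left; apply: ordA => //; apply: del1.
by right; apply: ordB => //; apply: del1.
Qed.
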